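(* Let $(M^{2n+1},g)$ be a Riemannian manifold equipped with a normal almost contact metric structure $(\theta,\xi,\eta)$. Then the second harmonic section equation $$\nabla^*\nabla\xi=|\nabla\xi|^2\xi-\tfrac12\bar J\circ\mathrm{trace}(\bar\nabla\bar J\otimes\nabla\xi)$$ for the structure $(\theta,\xi,\eta)$ is (i.e. is equivalent to) $$\nabla^*\nabla\xi-|\nabla\xi|^2\xi=\tfrac12\sum_{i=1}^{2n}[R(F_i,\theta F_i),\theta](\xi)+(\nabla_{\delta\theta}\theta)(\xi),$$ where $\{F_i\}_{i=1,\dots,2n}$ is an orthonormal frame on the horizontal sub-bundle $\mathcal F$ and $\delta\theta=\mathrm{trace}_g\nabla\theta$.
   Context: An almost contact metric structure $(\theta,\xi,\eta)$ on $(M^{2n+1},g)$: $\theta\in\mathrm{End}(TM)$, $\xi$ a vector field, $\eta$ a 1-form, with $\eta(\xi)=1$, $\theta^2=-\mathrm{Id}+\eta\otimes\xi$ and $g(\theta X,\theta Y)=g(X,Y)-\eta(X)\eta(Y)$. It is normal if the almost complex structure $\tilde J(X+f\partial_t)=\theta X-f\xi+\eta(X)\partial_t$ on $M\times\mathbb R$ is integrable. $\nabla$ is the Levi-Civita connection, $R(X,Y)=[\nabla_X,\nabla_Y]-\nabla_{[X,Y]}$; $\mathcal F=\xi^\perp$; $\bar J=\theta|_{\mathcal F}$; $\bar\nabla$ is the connection on $\mathcal F$ obtained by orthogonally projecting $\nabla$. For a local orthonormal frame $\{E_i\}$ of $TM$: $\nabla^*\nabla\xi=-\sum_i(\nabla_{E_i}\nabla_{E_i}\xi-\nabla_{\nabla_{E_i}E_i}\xi)$,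 $\delta\theta=\sum_i(\nabla_{E_i}\theta)(E_i)$, and $\mathrm{trace}(\bar\nabla\bar J\otimes\nabla\xi)=\sum_i(\bar\nabla_{E_i}\bar J)(\nabla_{E_i}\xi)$. *)

(* Defs.v *)
From HB Require Import structures.
From mathcomp Require Import all_boot all_order all_algebra.
From mathcomp Require Import all_classical all_reals all_analysis.
Set Implicit Arguments.
Unset Strict Implicit.
Unset Printing Implicit Defensive.
Import Order.TTheory GRing.Theory Num.Theory.
Import numFieldNormedType.Exports.
Local Open Scope classical_set_scope.
Local Open Scope ring_scope.

Fixpoint Ck (R : realType) (d k : nat) (O : set 'rV[R]_d) (f : 'rV[R]_d -> R)
    : Prop :=
  match k with
  | 0 => forall x, O x -> {for x, continuous f}
  | k'.+1 => forall i : 'I_d,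
      (forall x, O x -> derivable f x (delta_mx 0 i)) /\
      Ck k' O (fun x => 'D_(delta_mx 0 i) f x)
  end.

Definition smooth_on (R : realType) (d : nat) (O : set 'rV[R]_d)
    (f : 'rV[R]_d -> R) : Prop := forall k, Ck k O f.

(* A chart is given by total maps; [cmap] is meaningful on [dom] only, and
   [cinv] on the image of [dom] only. *)
Record chart (R : realType) (M : topologicalType) (d : nat) := Chart {
  dom : set M;
  cmap : M -> 'rV[R]_d;
  cinv : 'rV[R]_d -> M
}.

Section Manifold.
Variables (R : realType) (M : topologicalType) (d : nat).
Implicit Types (c : chart R M d) (A : set (chart R M d)) (U V W : set M).

Record is_chart c : Prop := {
  dom_open : open (dom c);
  image_open : open (cmap c @` dom c);
  cmapK : forall p, dom c p -> cinv c (cmap c p) = p;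
  cmap_cont : {within dom c, continuous (cmap c)};
  cinv_cont : {within cmap c @` dom c, continuous (cinv c)}
}.

Definition smooth_transition c c' : Prop := forall j : 'I_d,
  smooth_on (cmap c @` (dom c `&` dom c')) (fun x => cmap c' (cinv c x) 0 j).

Record smooth_manifold A : Prop := {
  mfd_hausdorff : hausdorff_space M;
  mfd_second_countable : @second_countable M;
  mfd_chart : forall c, A c -> is_chart c;
  mfd_cover : forall p, exists2 c, A c & dom c p;
  mfd_compatible : forall c c', A c -> A c' -> smooth_transition c c'
}.

Variable A : set (chart R M d).

Definition smooth U (f : M -> R) : Prop := forall c, A c ->
  smooth_on (cmap c @` (U `&` dom c)) (f \o cinv c).

Definition smooth_near (p : M) (f : M -> R) : Prop :=
  exists U, [/\ open U, U p & smooth U f].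

(* Tangent vectors act on germs of smooth functions.  They are represented as
   total operators on [M -> R] that vanish on functions which are not smooth
   near the base point, so that equality of vectors is equality of operators. *)

Definition coord_vector c (i : 'I_d) (p : M) : (M -> R) -> R := fun f =>
  if `[< smooth_near p f >]
  then 'D_(delta_mx 0 i) (f \o cinv c) (cmap c p) else 0.

Definition tangent (p : M) (v : (M -> R) -> R) : Prop :=
  forall c, A c -> dom c p ->
  exists w : 'I_d -> R, v = \sum_i w i *: coord_vector c i p.

(* Smooth vector field on the open set [U]; values outside [U] are irrelevant. *)
Record vfield U (X : M -> (M -> R) -> R) : Prop := {
  vfield_tangent : forall p, U p -> tangent p (X p);
  vfield_smooth : forall V f, open V -> V `<=` U -> smooth V f ->
    smooth V (fun p => X p f)
}.

Definition bracket (X Y : M -> (M -> R) -> R) : M -> (M -> R) -> R :=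
  fun p f => if `[< smooth_near p f >]
    then X p (fun q => Y q f) - Y p (fun q => X q f) else 0.

Record endo_field (T : M -> ((M -> R) -> R) -> ((M -> R) -> R)) : Prop := {
  endo_tangent : forall p v, tangent p v -> tangent p (T p v);
  endo_linear : forall p a u v, tangent p u -> tangent p v ->
    T p (a *: u + v) = a *: T p u + T p v;
  endo_smooth : forall U X, open U -> vfield U X ->
    vfield U (fun p => T p (X p))
}.

Record one_form (w : M -> ((M -> R) -> R) -> R) : Prop := {
  form_linear : forall p a u v, tangent p u -> tangent p v ->
    w p (a *: u + v) = a * w p u + w p v;
  form_smooth : forall U X, open U -> vfield U X -> smooth U (fun p => w p (X p))
}.

Record riemannian_metric (g : M -> ((M -> R) -> R) -> ((M -> R) -> R) -> R)
    : Prop := {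
  metric_sym : forall p u v, tangent p u -> tangent p v -> g p u v = g p v u;
  metric_linear : forall p a u v w, tangent p u -> tangent p v ->
    tangent p w -> g p (a *: u + v) w = a * g p u w + g p v w;
  metric_pos : forall p v, tangent p v -> v <> 0 -> 0 < g p v v;
  metric_smooth : forall U X Y, open U -> vfield U X -> vfield U Y ->
    smooth U (fun p => g p (X p) (Y p))
}.

(* [nabla p v Y] is the covariant derivative at [p], in the direction of the
   tangent vector [v], of a vector field [Y] smooth near [p]. *)
Definition cov (nabla : M -> ((M -> R) -> R) -> (M -> (M -> R) -> R) ->
    ((M -> R) -> R)) (X Y : M -> (M -> R) -> R) : M -> (M -> R) -> R :=
  fun p => nabla p (X p) Y.

Record connection (nabla : M -> ((M -> R) -> R) -> (M -> (M -> R) -> R) ->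
    ((M -> R) -> R)) : Prop := {
  conn_tangent : forall U p v Y, open U -> U p -> tangent p v -> vfield U Y ->
    tangent p (nabla p v Y);
  conn_smooth : forall U X Y, open U -> vfield U X -> vfield U Y ->
    vfield U (cov nabla X Y);
  conn_local : forall U p v Y Z, open U -> U p -> tangent p v ->
    (forall q, U q -> Y q = Z q) -> nabla p v Y = nabla p v Z;
  conn_linear : forall U p a u v Y, open U -> U p -> tangent p u ->
    tangent p v -> vfield U Y ->
    nabla p (a *: u + v) Y = a *: nabla p u Y + nabla p v Y;
  conn_leibniz : forall U p v f Y Z, open U -> U p -> tangent p v ->
    smooth U f -> vfield U Y -> vfield U Z ->
    nabla p v (fun q => f q *: Y q + Z q) =
      f p *: nabla p v Y + v f *: Y p + nabla p v Z
}.

Record levi_civita (g : M -> ((M -> R) -> R) -> ((M -> R) -> R) -> R)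
    (nabla : M -> ((M -> R) -> R) -> (M -> (M -> R) -> R) -> ((M -> R) -> R))
    : Prop := {
  lc_connection : connection nabla;
  lc_torsion_free : forall U X Y p, open U -> vfield U X -> vfield U Y ->
    U p -> cov nabla X Y p - cov nabla Y X p = bracket X Y p;
  lc_metric : forall U p v Y Z, open U -> U p -> tangent p v ->
    vfield U Y -> vfield U Z ->
    v (fun q => g q (Y q) (Z q)) =
      g p (nabla p v Y) (Z p) + g p (Y p) (nabla p v Z)
}.

(* The almost complex structure [J] is induced by local complex coordinates
   z_k = x_k + i y_k, the real coordinates of the chart being ordered as
   x_0, y_0, x_1, y_1, ... *)
Definition integrable (J : M -> ((M -> R) -> R) -> ((M -> R) -> R)) : Prop :=
  forall p, exists c, [/\ is_chart c, dom c p,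
    forall c', A c' -> smooth_transition c c' /\ smooth_transition c' c &
    forall q, dom c q -> forall (k : nat) (a b : 'I_d),
      a = k.*2 :> nat -> b = k.*2.+1 :> nat ->
      J q (coord_vector c a q) = coord_vector c b q /\
      J q (coord_vector c b q) = - coord_vector c a q].

End Manifold.

Section ProductWithLine.
Variables (R : realType) (M : topologicalType) (d : nat).

Definition line_chart (c : chart R M d) : chart R (M * R)%type (d + 1) :=
  {| dom := [set q | dom c q.1];
     cmap := fun q => row_mx (cmap c q.1) (const_mx q.2);
     cinv := fun x => (cinv c (lsubmx x), x 0 (rshift d ord0)) |}.

Definition line_atlas (A : set (chart R M d))
    : set (chart R (M * R)%type (d + 1)) := line_chart @` A.

Variable A : set (chart R M d).

Definition lift_vector (q : M * R) (u : (M -> R) -> R) : (M * R -> R) -> R :=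
  fun f => if `[< smooth_near (line_atlas A) q f >]
    then u (fun p => f (p, q.2)) else 0.

Definition d_dt (q : M * R) : (M * R -> R) -> R := fun f =>
  if `[< smooth_near (line_atlas A) q f >]
  then derive1 (fun s : R => f (q.1, s)) q.2 else 0.

(* J(X + f d/dt) = theta X - f xi + eta(X) d/dt, where the components of a
   tangent vector [w] of M x R are recovered as X = d(fst)(w), f = w(snd). *)
Definition cone_J (theta : M -> ((M -> R) -> R) -> ((M -> R) -> R))
    (xi : M -> (M -> R) -> R) (eta : M -> ((M -> R) -> R) -> R)
    (q : M * R) (w : (M * R -> R) -> R) : (M * R -> R) -> R :=
  let X : (M -> R) -> R := fun h => w (h \o fst) in
  let f : R := w snd in
  lift_vector q (theta q.1 X - f *: xi q.1) + eta q.1 X *: d_dt q.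

Definition normal theta xi eta : Prop :=
  integrable (line_atlas A) (cone_J theta xi eta).

End ProductWithLine.

Section AlmostContact.
Variables (R : realType) (M : topologicalType) (d : nat).
Variable A : set (chart R M d).
Variable g : M -> ((M -> R) -> R) -> ((M -> R) -> R) -> R.
Variable nabla : M -> ((M -> R) -> R) -> (M -> (M -> R) -> R) ->
  ((M -> R) -> R).
Variable theta : M -> ((M -> R) -> R) -> ((M -> R) -> R).
Variable xi : M -> (M -> R) -> R.
Variable eta : M -> ((M -> R) -> R) -> R.
Implicit Types (X Y Z V : M -> (M -> R) -> R) (p : M).

Record almost_contact_metric : Prop := {
  acm_theta : endo_field A theta;
  acm_xi : vfield A setT xi;
  acm_eta : one_form A eta;
  acm_eta_xi : forall p, eta p (xi p) = 1;
  acm_theta2 : forall p v, tangent A p v ->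
    theta p (theta p v) = - v + eta p v *: xi p;
  acm_metric : forall p u v, tangent A p u -> tangent A p v ->
    g p (theta p u) (theta p v) = g p u v - eta p u * eta p v
}.

Definition horizontal p (v : (M -> R) -> R) : Prop :=
  tangent A p v /\ g p v (xi p) = 0.

(* Orthonormal frame, over [U], of the sub-bundle of TM with fibres [B p]. *)
Record orthonormal_frame (B : M -> ((M -> R) -> R) -> Prop) (U : set M)
    (k : nat) (E : 'I_k -> M -> (M -> R) -> R) : Prop := {
  frame_vfield : forall i, vfield A U (E i);
  frame_mem : forall i p, U p -> B p (E i p);
  frame_orthonormal : forall i j p, U p -> g p (E i p) (E j p) = (i == j)%:R;
  frame_span : forall p v, U p -> B p v ->
    exists a : 'I_k -> R, v = \sum_i a i *: E i p
}.

Definition app (T : M -> ((M -> R) -> R) -> ((M -> R) -> R)) X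
  : M -> (M -> R) -> R := fun p => T p (X p).

Definition curvature X Y Z p : (M -> R) -> R :=
  cov nabla X (cov nabla Y Z) p - cov nabla Y (cov nabla X Z) p
  - cov nabla (bracket A X Y) Z p.

(* [R(X, Y), theta](Z) *)
Definition curvature_theta X Y Z p : (M -> R) -> R :=
  curvature X Y (app theta Z) p - theta p (curvature X Y Z p).

(* (nabla_X theta)(Y) *)
Definition nabla_theta X Y p : (M -> R) -> R :=
  cov nabla X (app theta Y) p - theta p (cov nabla X Y p).

(* Orthogonal projection on the complement of [xi], a unit vector for an
   almost contact metric structure. *)
Definition hproj p (v : (M -> R) -> R) : (M -> R) -> R :=
  v - g p v (xi p) *: xi p.

Definition bar_nabla X V p : (M -> R) -> R := hproj p (cov nabla X V p).

(* (bar_nabla_X bar_J)(V) for [V] horizontal; bar_J is [theta] on horizontal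
   vectors. *)
Definition bar_nabla_J X V p : (M -> R) -> R :=
  bar_nabla X (app theta V) p - theta p (bar_nabla X V p).

Section Traces.
Variables (k : nat) (E : 'I_k -> M -> (M -> R) -> R).

Definition rough_laplacian Z p : (M -> R) -> R :=
  - \sum_i (cov nabla (E i) (cov nabla (E i) Z) p
            - cov nabla (cov nabla (E i) (E i)) Z p).

Definition norm2_nabla Z p : R :=
  \sum_i g p (cov nabla (E i) Z p) (cov nabla (E i) Z p).

Definition delta_theta p : (M -> R) -> R := \sum_i nabla_theta (E i) (E i) p.

Definition trace_bar_J p : (M -> R) -> R :=
  \sum_i bar_nabla_J (E i) (cov nabla (E i) xi) p.

End Traces.

Definition second_harmonic_section_equation : Prop :=
  forall (U : set M) (E : 'I_d -> M -> (M -> R) -> R), open U ->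
  orthonormal_frame (tangent A) U E -> forall p, U p ->
  rough_laplacian E xi p =
    norm2_nabla E xi p *: xi p - 2^-1 *: theta p (trace_bar_J E p).

End AlmostContact.

(* Main.v *)
(* Normality implies that nabla xi commutes with theta.  Granted this, put
   L = sum_i (nabla_{E_i} nabla_{E_i} xi - nabla_{nabla_{E_i} E_i} xi) and
   T = sum_i (nabla_{E_i} theta)(nabla_{E_i} xi).  Differentiating
   nabla_{theta X} xi = theta (nabla_X xi) and tracing gives
   sum_i R(F_i, theta F_i) xi = 2 (T + theta L - nabla_{delta theta} xi).
   With K = L + |nabla xi|^2 xi, which is horizontal, the first equation reads
   K = (1/2) theta T and the second one - K = - theta T + K.

   The commutation follows from L_xi theta = 0 and
   d eta(theta X, Z) + d eta(X, theta Z) = 0: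
   (X, Z) |-> g((nabla_xi theta) X, Z) is skew by metricity and, by these two
   identities, symmetric.  Both identities come from the complex coordinates
   x + i y on M x R: on M x {0} one has dx/dt = - xi y and dy/dt = xi x, so that
   the equations (J W) x = - W y, (J W) y = W x and their t-derivatives only
   involve functions on M, and the relevant components of the Nijenhuis tensor
   vanish on x and y by direct computation. *)

Require Import Defs.
From HB Require Import structures.
From mathcomp Require Import all_boot all_order all_algebra.
From mathcomp Require Import all_classical all_reals all_analysis.
From mathcomp Require Import ring lra.
Import Order.TTheory GRing.Theory Num.Theory.
Import numFieldNormedType.Exports.
Set Implicit Arguments.
Unset Strict Implicit.
Unset Printing Implicit Defensive.
Local Open Scope classical_set_scope.
Local Open Scope ring_scope.

(** * Calculus in several variables *)

Section Calculus.
Variables (R : realType) (d : nat).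
Implicit Types (f g : 'rV[R]_d -> R) (O : set 'rV[R]_d) (x v h : 'rV[R]_d).

(** Integrability is given through charts, so the tensor identities of normality are tested on
    coordinate functions. A complex chart of M x R need not belong to the atlas that defines tangent
    vectors, and its transitions to that atlas are only known to have continuous iterated partial
    derivatives: this is why differentiability, the chain rule and the symmetry of second
    derivatives are derived from [Ck]. Symmetry lets d/dt pass through a vector of M when the
    Cauchy-Riemann equations are differentiated in t.

    A vector u + m d/dt that kills all complex coordinates is zero; on the slice t = 0 this reads:
    if u x = m (xi y) for all of them, then u = 0 and m = 0. The Nijenhuis tensor is met in exactly
    this form: its M-component on (d/dt, X) gives L_xi theta = 0, its d/dt-component on lifts (X, Y)
    gives the identity on d eta.

    The first equation mentions only the frame E, the second also quantifies over a horizontal frame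
    F on the same open set. One implication therefore needs such an F, built near any point by
    reflecting E. *)

Lemma is_derive_line f z v (s : R) :
  derivable f (s *: v + z) v ->
  is_derive s 1 (fun t : R => f (t *: v + z)) ('D_v f (s *: v + z)).
Proof.
have E : (fun h : R => h^-1 *: (f (h *: v + (s *: v + z)) - f (s *: v + z)))
  = (fun h : R => h^-1 *: (f ((h *: 1 + s) *: v + z) - f (s *: v + z))).
  by apply/funext => h; rewrite scalerDl addrA [h *: 1]mulr1.
move=> df; split; first by move: df; rewrite /derivable /= E.
by rewrite /derive /= E.
Qed.

(** Absolute values cover increments of either sign at once, since the coordinates of a displacement
    have no prescribed sign. *)
Lemma MVT_sym (phi dphi : R -> R) (h : R) :
  (forall s : R, `|s| <= `|h| -> is_derive s 1 phi (dphi s)) ->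
  exists2 c, `|c| <= `|h| & phi h - phi 0 = dphi c * h.
Proof.
move=> H.
have cont s : `|s| <= `|h| -> {for s, continuous phi}.
  move=> /H Hs; apply: differentiable_continuous.
  by apply/derivable1_diffP; case: Hs.
have [h0|h0] := leP 0 h.
- have sub s : s \in `[0, h] -> `|s| <= `|h|.
    by rewrite in_itv /= => /andP[s0 sh]; rewrite !ger0_norm.
  have [||c cI ->] := @MVT_segment R phi dphi 0 h h0.
  + by move=> s sI; apply/H/sub; apply: subset_itv_oo_cc.
  + by apply: continuous_in_subspaceT => s /set_mem sI; apply/cont/sub.
  by exists c; rewrite ?subr0 //; apply: sub.
- have sub s : s \in `[h, 0] -> `|s| <= `|h|.
    rewrite in_itv /= => /andP[s0 sh].
    by rewrite (ltr0_norm h0) ler0_norm // lerN2.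
  have [||c cI E] := @MVT_segment R phi dphi h 0 (ltW h0).
  + by move=> s sI; apply/H/sub; apply: subset_itv_oo_cc.
  + by apply: continuous_in_subspaceT => s /set_mem sI; apply/cont/sub.
  exists c; first exact: sub.
  by rewrite -[LHS]opprB E; ring.
Qed.

Lemma normr_coord h i : `|h 0 i| <= `|h|.
Proof.
by rewrite [leRHS]/Num.Def.normr /= mx_normrE; apply: (le_bigmax _ _ (0, i)).
Qed.

Lemma normr_row_le h (e : R) : 0 <= e -> (forall i, `|h 0 i| <= e) -> `|h| <= e.
Proof.
move=> e0 H; rewrite [leLHS]/Num.Def.normr /= mx_normrE.
by apply: bigmax_le => // -[i j] _ /=; rewrite ord1.
Qed.

(** The path from x to x + h follows the coordinate axes, one leg per coordinate. On each leg the
    mean value theorem turns the increment of f into a partial derivative at a nearby point, and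
    continuity of the partials at x bounds the error by a fraction of |h|. *)
Lemma C1_differentiable f O x : open O -> O x ->
  (forall i, forall y, O y -> derivable f y (delta_mx 0 i)) ->
  (forall i, {for x, continuous (fun y => 'D_(delta_mx 0 i) f y)}) ->
  differentiable f x.
Proof.
move=> oO Ox df cf.
pose L h : R := \sum_i h 0 i * 'D_(delta_mx 0 i) f x.
have Llin : linear L.
  move=> a u w; rewrite /L scaler_sumr -big_split /=; apply: eq_bigr => i _.
  by rewrite !mxE mulrDl -mulrA.
pose LM := GRing.isLinear.Build _ _ _ _ _ Llin.
pose LL : {linear 'rV[R]_d -> R} := HB.pack L LM.
have Lcont : continuous LL.
  apply: continuous_big => [|i _ /= y]; first exact: add_continuous.
  apply: (@continuousM _ _ (fun h : 'rV[R]_d => h 0 i : R) (cst _));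
    last exact: cst_continuous.
  exact: (differentiable_continuous (@differentiable_coord _ _ _ y 0 i)).
suff expand : (f : 'rV[R]_d -> R^o) \o shift x = cst (f x) + (LL : 'rV[R]_d ->
  R^o) +o_ (0 : 'rV[R]_d) (id : 'rV[R]_d -> 'rV[R]_d).
  have dE := diff_unique Lcont expand.
  by apply/diff_locallyP; rewrite dE; split.
apply/(@eqaddoP R 'rV[R]_d R 'rV[R]_d (nbhs_filter_on (0 : 'rV[R]_d))) =>
  _/posnumP[e].
(* The tolerance is divided by d + 1 and not by d, to remain positive when d = 0; the d legs still
   add up to at most e |h|. *)
have d1 : 0 < d.+1%:R :> R by rewrite ltr0n.
have /nbhs_ballP[r /= r0 rO] := open_nbhs_nbhs (conj oO Ox).
have [r' /= r'0 r'P] : exists2 r', 0 < r' & forall i y, `|y - x| < r' ->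
    `|'D_(delta_mx 0 i) f y - 'D_(delta_mx 0 i) f x| <= e%:num / d.+1%:R.
  have : \forall y \near x, forall i : 'I_d,
    `|'D_(delta_mx 0 i) f y - 'D_(delta_mx 0 i) f x| <= e%:num / d.+1%:R.
    apply: (@filter_forall _ _ _ (nbhs x)) => i.
    have /cvgrPdist_le /(_ (e%:num / d.+1%:R)) := cf i.
    move=> /(_ (divr_gt0 (gt0 e) d1)).
    by apply: filterS => y; rewrite distrC.
  move=> /nbhs_ballP[r' /= r'0 H]; exists r' => // i y yr.
  by apply: H; rewrite -ball_normE /= distrC.
apply/nbhs_ballP; exists (Num.min r r'); first by rewrite /= lt_min r0.
move=> h; rewrite -ball_normE /= sub0r normrN lt_min => /andP[hr hr'].
(* Corners of the path from x to x + h: the leg from [z i] to [z i.+1] moves coordinate i only. *)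
pose z (k : nat) : 'rV[R]_d := x + \row_j (if (j < k)%N then h 0 j else 0).
have zin k (s : R) (i : 'I_d) : i = k :> nat -> `|s| <= `|h 0 i| ->
    `|s *: delta_mx 0 i + z k - x| <= `|h|.
  move=> ik sh; apply: normr_row_le => // j; rewrite !mxE eqxx /=.
  have -> : s * (j == i)%:R + (x 0 j + (if (j < k)%N then h 0 j else 0)) - x 0 j
     = if j == i then s else if (j < k)%N then h 0 j else 0.
    by case: eqP => [->|_] /=; rewrite ?ik ?ltnn ?mulr1 ?mulr0 ?addr0 ?add0r
      ?addrK // addrC addKr.
  case: eqP => _; first exact: le_trans sh (normr_coord _ _).
  by case: ifP => _; rewrite ?normr0 ?normr_ge0 ?normr_coord.
have step (i : 'I_d) : `|f (z i.+1) - f (z i) - h 0 i * 'D_(delta_mx 0 i) f x|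
    <= e%:num / d.+1%:R * `|h|.
  have zS : z i.+1 = h 0 i *: delta_mx 0 i + z i.
    apply/rowP => j; rewrite !mxE eqxx /= ltnS leq_eqVlt val_eqE.
    by case: eqP => [->|_] /=; rewrite ?ltnn ?mulr1 ?mulr0 ?addr0 ?add0r // addrC.
  have [s|c ch] := @MVT_sym (fun t => f (t *: delta_mx 0 i + z i))
      (fun t => 'D_(delta_mx 0 i) f (t *: delta_mx 0 i + z i)) (h 0 i).
    move=> sh; apply: is_derive_line; apply: df; apply: rO.
    rewrite -ball_normE /= distrC; apply: le_lt_trans hr; exact: zin.
  rewrite scale0r add0r -zS => ->.
  rewrite [_ * h 0 i]mulrC -mulrBr normrM mulrC; apply: ler_pM => //.
    by apply: r'P; apply: le_lt_trans hr'; exact: zin.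
  exact: normr_coord.
have tele : f (h + x) - f x = \sum_(i < d) (f (z i.+1) - f (z i)).
  rewrite -(big_mkord xpredT (fun i => f (z i.+1) - f (z i))) telescope_sumr //.
  congr (f _ - f _).
    by apply/rowP => j; rewrite !mxE ltn_ord addrC.
  by apply/rowP => j; rewrite !mxE ltn0 addr0.
rewrite /= -[(_ - _) h]/(f (h + x) - (f x + L h)) opprD addrA tele.
rewrite /L -sumrB; apply: le_trans (ler_norm_sum _ _ _) _.
apply: le_trans (ler_sum _ (fun i _ => step i)) _.
rewrite sumr_const card_ord.
rewrite -[leLHS]mulr_natl.
rewrite mulrA ler_wpM2r //  mulrCA -[leRHS]mulr1 ler_wpM2l //.
by rewrite ler_pdivrMr // mul1r ler_nat.
Qed.

End Calculus.

Section DifferentiableRow.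
Variables (R : realType).

Lemma differentiable_row m d (V : normedModType R) (Phi : V -> 'M[R]_(m, d)) x :
  (forall i j, differentiable (fun y => Phi y i j : R) x) -> differentiable Phi x.
Proof.
move=> dPhi.
have -> : Phi = \sum_i \sum_j (fun y => (Phi y i j : R) *: delta_mx i j).
  apply/funext => y; rewrite fct_sumE [LHS]matrix_sum_delta.
  by apply: eq_bigr => i _; rewrite fct_sumE.
apply: differentiable_sum => i; apply: differentiable_sum => j.
exact: differentiableZl (dPhi i j).
Qed.

Lemma derive_differentiable_sum d (f : 'rV[R]_d -> R) x v : differentiable f x ->
  'D_v f x = \sum_j v 0 j * 'D_(delta_mx 0 j) f x.
Proof.
move=> df; rewrite deriveE // {1}(row_sum_delta v) linear_sum.
by apply: eq_bigr => j _; rewrite linearZ deriveE.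
Qed.

Lemma chain_rule m d (Phi : 'rV[R]_m -> 'rV[R]_d) (F : 'rV[R]_d -> R) x v :
  (forall j, differentiable (fun y => Phi y 0 j : R) x) ->
  differentiable F (Phi x) ->
  differentiable (F \o Phi) x /\
  'D_v (F \o Phi) x =
    \sum_j 'D_v (fun y => Phi y 0 j) x * 'D_(delta_mx 0 j) F (Phi x).
Proof.
move=> dPhi dF.
have dP : differentiable Phi x by apply: differentiable_row => i j; rewrite ord1.
have dc := differentiable_comp dP dF; split=> //.
rewrite deriveE // diff_comp //= -deriveE // (derive_differentiable_sum _ dF).
apply: eq_bigr => j _; rewrite -deriveE //.
have dPv : derivable Phi x v by apply: diff_derivable.
by rewrite (derive_mx dPv) mxE.
Qed.

End DifferentiableRow.

Lemma derive_coord (R : realType) d (i j : 'I_d) (x : 'rV[R]_d) :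
  'D_(delta_mx 0 i) (fun y : 'rV[R]_d => y 0 j : R) x = (i == j)%:R.
Proof.
have := derive_mx (@derivable_id R 'rV[R]_d x (delta_mx 0 i)).
by rewrite derive_id => /matrixP /(_ 0 j); rewrite !mxE eqxx eq_sym => <-.
Qed.

(** * Functions of class Ck and the symmetry of second derivatives *)

Section Ck.
Variables (R : realType) (d : nat).
Implicit Types (f g : 'rV[R]_d -> R) (O : set 'rV[R]_d) (x v h : 'rV[R]_d).

Lemma near_open O x (P : 'rV[R]_d -> Prop) : open O -> O x ->
  (forall y, O y -> P y) -> \forall y \near x, P y.
Proof. by move=> oO Ox H; apply: filterS H _; exact: open_nbhs_nbhs. Qed.

Lemma Ck_ext k O f g : open O -> (forall x, O x -> f x = g x) ->
  Ck k O f -> Ck k O g.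
Proof.
move=> oO; elim: k f g => [|k IH] f g fg /=.
  move=> cf x Ox; have := cf x Ox; rewrite /prop_for /continuous_at -(fg x Ox).
  have E : {near x, f =1 g} by exact: (near_open oO Ox).
  exact: (cvg_trans (near_eq_cvg E)).
move=> cf i; have [df ck] := cf i; split=> [x Ox|].
  apply: near_eq_derivable (df x Ox); exact: (near_open oO Ox).
by apply: IH ck => x Ox; apply: near_eq_derive; exact: (near_open oO Ox).
Qed.

Lemma Ck_sub k O O' f : O' `<=` O -> Ck k O f -> Ck k O' f.
Proof.
move=> OO; elim: k f => [|k IH] f /= cf; first by move=> x /OO /cf.
by move=> i; have [df ck] := cf i; split=> [x /OO /df//|]; apply: IH.
Qed.

Lemma Ck1_differentiable O f x : open O -> Ck 1 O f -> O x -> differentiable f x.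
Proof.
move=> oO cf Ox; apply: (C1_differentiable oO Ox) => i; have [df ck] := cf i => //.
exact: ck.
Qed.

(** Only the base case has content: existence of partial derivatives does not give continuity, so a
    C1 function is first shown to be differentiable. *)
Lemma CkS k O f : open O -> Ck k.+1 O f -> Ck k O f.
Proof.
move=> oO; elim: k f => [|k IH] f cf.
  by move=> x Ox; apply: differentiable_continuous; apply: Ck1_differentiable cf Ox.
by move=> i; have [df ck] := cf i; split=> //; apply: IH.
Qed.

Lemma Ck_cst k O (a : R) : Ck k O (fun=> a).
Proof.
elim: k a => [|k IH] a /=; first by move=> x _; exact: cst_continuous.
move=> i; split=> [x _|]; first exact: derivable_cst.
have -> : (fun x => 'D_(delta_mx 0 i) (fun=> a) x) = (fun=> 0 : R).
  by apply/funext => x; rewrite (derive_cst a).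
exact: IH.
Qed.

Lemma Ck_coord k O (j : 'I_d) : Ck k O (fun x => x 0 j).
Proof.
case: k => [|k].
  move=> x _; exact: (differentiable_continuous (@differentiable_coord _ _ _ x 0
    j)).
move=> i; split=> [x _|]; first exact/diff_derivable/differentiable_coord.
have -> : (fun x => 'D_(delta_mx 0 i) (fun y : 'rV[R]_d => y 0 j : R) x) =
  fun=> (i == j)%:R by apply/funext => x; exact: derive_coord.
exact: Ck_cst.
Qed.

Lemma CkD k O f g : open O -> Ck k O f -> Ck k O g -> Ck k O (fun x => f x + g x).
Proof.
move=> oO; elim: k f g => [|k IH] f g /= cf cg.
  by move=> x Ox; apply: (@continuousD _ _ _ f g); [exact: cf|exact: cg].
move=> i; have [df cf'] := cf i; have [dg cg'] := cg i; split.
  by move=> x Ox; apply: derivableD; [exact: df|exact: dg].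
apply: Ck_ext oO _ (IH _ _ cf' cg') => x Ox.
by rewrite -deriveD //; [exact: df|exact: dg].
Qed.

Lemma CkM k O f g : open O -> Ck k O f -> Ck k O g -> Ck k O (fun x => f x * g x).
Proof.
move=> oO; elim: k f g => [|k IH] f g cf cg.
  by move=> x Ox; apply: (@continuousM _ _ f g); [exact: cf|exact: cg].
move=> i; have [df cf'] := cf i; have [dg cg'] := cg i; split.
  by move=> x Ox; apply: derivableM; [exact: df|exact: dg].
apply: (Ck_ext oO _ (CkD oO (IH _ _ (CkS oO cf) cg') (IH _ _ (CkS oO cg) cf'))).
by move=> x Ox; rewrite -[RHS]/('D_(delta_mx 0 i) (f * g) x) deriveM //;
  [exact: df|exact: dg].
Qed.

(** The derivative - (1/f)^2 f' involves 1/f only at the lower order, which the induction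
    supplies. *)
Lemma CkV k O f : open O -> (forall x, O x -> f x != 0) -> Ck k O f ->
  Ck k O (fun x => (f x)^-1).
Proof.
move=> oO f0; elim: k f f0 => [|k IH] f f0 cf.
  by move=> x Ox; apply: (@continuousV _ _ f); [exact: f0|exact: cf].
move=> i; have [df cf'] := cf i; split.
  by move=> x Ox; apply: derivableV; [exact: f0|exact: df].
have cV := IH _ f0 (CkS oO cf).
apply: (Ck_ext oO _ (CkM oO (Ck_cst k O (-1)) (CkM oO (CkM oO cV cV) cf'))).
move=> x Ox; rewrite deriveV ?f0 //; last exact: df.
by rewrite mulN1r scaleNr -expr2 exprVn.
Qed.

Lemma smooth_differentiable O f x : open O -> smooth_on O f -> O x ->
  differentiable f x.
Proof. by move=> oO sf; apply: Ck1_differentiable (sf 1). Qed.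

Lemma smooth_derivable O f x i : smooth_on O f -> O x ->
  derivable f x (delta_mx 0 i).
Proof. by move=> sf Ox; have [df _] := sf 1 i; apply: df. Qed.

Lemma smooth_derive O f i : smooth_on O f ->
  smooth_on O (fun x => 'D_(delta_mx 0 i) f x).
Proof. by move=> sf k; have [] := sf k.+1 i. Qed.

(** The mean value theorem is applied twice: along e_i to the difference of f between two parallel
    segments, then along e_j to the resulting increment of the i-th partial derivative. *)
Lemma MVT_second_difference O f x (r h : R) i j : open O -> Ck 2 O f ->
  (forall y, `|y - x| < r -> O y) -> `|h| *+ 2 < r ->
  exists2 y, `|y - x| <= `|h| *+ 2 &
    f (h *: delta_mx 0 i + (h *: delta_mx 0 j + x)) - f (h *: delta_mx 0 i + x)
    - (f (h *: delta_mx 0 j + x) - f x)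
    = h * h * 'D_(delta_mx 0 j) (fun y => 'D_(delta_mx 0 i) f y) y.
Proof.
move=> oO cf rO hr.
have nd (k : 'I_d) : `|delta_mx 0 k : 'rV[R]_d| <= 1.
  by apply: normr_row_le => // l; rewrite mxE eqxx /=; case: eqP;
    rewrite ?normr1 ?normr0.
have dist (s t : R) : `|s| <= `|h| -> `|t| <= `|h| ->
    `|t *: delta_mx 0 j + (s *: delta_mx 0 i + x) - x| <= `|h| *+ 2.
  move=> sh th; rewrite addrA addrK mulr2n; apply: le_trans (ler_normD _ _) _.
  by apply: lerD; rewrite normrZ -[leRHS]mulr1 ler_pM.
have inO (s t : R) : `|s| <= `|h| -> `|t| <= `|h| ->
    O (t *: delta_mx 0 j + (s *: delta_mx 0 i + x)).
  by move=> sh th; apply/rO/(le_lt_trans (dist _ _ sh th)).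
have [dfi ck] := cf i; have [dfij _] := ck j.
have inO0 (s : R) : `|s| <= `|h| -> O (s *: delta_mx 0 i + x).
  by move=> sh; have := inO s 0 sh; rewrite normr0 scale0r add0r; apply.
have inO1 (s : R) : `|s| <= `|h| -> O (s *: delta_mx 0 i + (h *: delta_mx 0 j + x)).
  by move=> sh; have := inO s h sh (lexx _); rewrite addrCA.
have [s sh|c ch] := @MVT_sym R
  (fun s => f (s *: delta_mx 0 i + (h *: delta_mx 0 j + x)) - f (s *: delta_mx 0
    i + x))
  (fun s => 'D_(delta_mx 0 i) f (s *: delta_mx 0 i + (h *: delta_mx 0 j + x)) -
            'D_(delta_mx 0 i) f (s *: delta_mx 0 i + x)) h.
  by apply: is_deriveB; apply: is_derive_line; apply: dfi;
    [exact: inO1|exact: inO0].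
rewrite !scale0r !add0r => ->.
have [t th|c' ch'] := @MVT_sym R
  (fun t => 'D_(delta_mx 0 i) f (t *: delta_mx 0 j + (c *: delta_mx 0 i + x)))
  (fun t => 'D_(delta_mx 0 j) (fun y => 'D_(delta_mx 0 i) f y)
     (t *: delta_mx 0 j + (c *: delta_mx 0 i + x))) h.
  apply: (@is_derive_line _ _ (fun y => 'D_(delta_mx 0 i) f y)).
  by apply: dfij; exact: inO.
rewrite scale0r add0r addrCA => E; exists (c' *: delta_mx 0 j + (c *: delta_mx 0
  i + x)).
  exact: dist.
by rewrite E; ring.
Qed.

Lemma dist_half_le (a b c e : R) :
  `|a - c| < e / 2 -> `|b - c| < e / 2 -> `|a - b| <= e.
Proof.
move=> ac bc; rewrite (splitr e) distrC.
by apply: le_trans (ler_distD c _ _) (lerD (ltW bc) _); rewrite distrC ltW.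
Qed.

(** The second difference of f is symmetric in i and j, so the two mixed derivatives agree when
    evaluated at two suitable points near x. Continuity brings both points back to x, up to e. *)
Lemma Schwarz O f x i j : open O -> Ck 2 O f -> O x ->
  'D_(delta_mx 0 i) (fun y => 'D_(delta_mx 0 j) f y) x =
  'D_(delta_mx 0 j) (fun y => 'D_(delta_mx 0 i) f y) x.
Proof.
move=> oO cf Ox.
have [r /= r0 rO] : exists2 r, 0 < r & forall y, `|y - x| < r -> O y.
  have /nbhs_ballP[r /= r0 rO] := open_nbhs_nbhs (conj oO Ox).
  by exists r => // y yr; apply: rO; rewrite -ball_normE /= distrC.
apply/eqP; rewrite -subr_eq0 -normr_le0; apply/ler_addgt0Pl => e e0; rewrite addr0.
have cont a b : exists2 r', 0 < r' & forall y, `|y - x| < r' ->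
    `|'D_(delta_mx 0 a) (fun y => 'D_(delta_mx 0 b) f y) x -
      'D_(delta_mx 0 a) (fun y => 'D_(delta_mx 0 b) f y) y| < e / 2.
  have [_ cb] := cf b; have [_ cab] := cb a.
  have /cvgrPdist_lt /(_ (e / 2)) := cab x Ox.
  rewrite divr_gt0 // => /(_ isT) /nbhs_ballP[r' /= r'0 r'P]; exists r' => // y yr.
  by apply: r'P; rewrite -ball_normE /= distrC.
have [r1 r10 r1P] := cont i j; have [r2 r20 r2P] := cont j i.
pose m := Num.min r (Num.min r1 r2).
have m0 : 0 < m by rewrite !lt_min r0 r10.
(* Two steps of length h stay within m / 2, hence strictly inside the ball of radius m. *)
pose h := m / 4.
have h0 : 0 < h by rewrite divr_gt0.
have hm : `|h| *+ 2 < m.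
  by rewrite gtr0_norm // /h -mulr_natl; lra.
have := hm; rewrite !lt_min => /and3P[hr h1 h2].
have [y1 y1h E1] := MVT_second_difference j i oO cf rO hr.
have [y2 y2h E2] := MVT_second_difference i j oO cf rO hr.
have E : 'D_(delta_mx 0 i) (fun y => 'D_(delta_mx 0 j) f y) y1 =
         'D_(delta_mx 0 j) (fun y => 'D_(delta_mx 0 i) f y) y2.
  have hh : h * h != 0 by rewrite mulf_neq0 // lt0r_neq0.
  apply: (mulfI hh); apply: etrans (esym E1) (etrans _ E2).
  rewrite [h *: delta_mx 0 j + (h *: delta_mx 0 i + x)]addrCA.
  by move: (f _) (f _) (f _) (f _) => u1 u2 u3 u4; ring.
have H1 := r1P _ (le_lt_trans y1h h1); have H2 := r2P _ (le_lt_trans y2h h2).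
by rewrite E in H1; exact: dist_half_le H1 H2.
Qed.

End Ck.

(** The difference quotients of [f \o phi] along v and of [f] along w are the same function of h, so
    the two derivatives are compared without the chain rule. *)
Lemma derive_affine (R : realType) (V W : normedModType R) (phi : V -> W)
    (f : W -> R) x v w :
  (forall h : R, phi (h *: v + x) = h *: w + phi x) ->
  ('D_v (f \o phi) x = 'D_w f (phi x)) /\
  (derivable f (phi x) w -> derivable (f \o phi) x v).
Proof.
move=> E; rewrite /derive /derivable /=.
have -> : (fun h : R => h^-1 *: (f (phi (h *: v + x)) - f (phi x))) =
  (fun h : R => h^-1 *: (f (h *: w + phi x) - f (phi x))) by apply/funext => h;
    rewrite E.
by [].
Qed.

Section CkAffine.
Variables (R : realType) (m d : nat) (phi : 'rV[R]_m -> 'rV[R]_d).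
Hypothesis phi_cont : continuous phi.
Hypothesis phi_delta : forall i,
  (exists j, forall x (h : R), phi (h *: delta_mx 0 i + x) = h *: delta_mx 0 j +
    phi x)
  \/ (forall x (h : R), phi (h *: delta_mx 0 i + x) = phi x).

(** Each basis direction is carried to a basis direction or collapsed, so partial derivatives pull
    back to partial derivatives or to 0 and the induction on k closes. The two instances are the
    slice x -> (x, t) and the projection (x, t) -> x. *)
Lemma Ck_affine k O O' (f : 'rV[R]_d -> R) : (forall x, O' x -> O (phi x)) ->
  Ck k O f -> Ck k O' (f \o phi).
Proof.
move=> OO; elim: k f => [|k IH] f cf.
  by move=> x Ox; apply: continuous_comp; [exact: phi_cont|exact/cf/OO].
move=> i; case: (phi_delta i) => [[j E]|E].
  have [df cf'] := cf j; split=> [x Ox|].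
    by have [_] := derive_affine f (E x); apply; apply/df/OO.
  have -> : (fun x => 'D_(delta_mx 0 i) (f \o phi) x) =
      (fun x => 'D_(delta_mx 0 j) f x) \o phi.
    by apply/funext => x; have [] := derive_affine f (E x).
  exact: IH.
have E' x (h : R) : phi (h *: delta_mx 0 i + x) = h *: 0 + phi x.
  by rewrite E scaler0 add0r.
split=> [x Ox|]; first by have [_] := derive_affine f (E' x); apply;
  exact: derivable0.
have -> : (fun x => 'D_(delta_mx 0 i) (f \o phi) x) = fun=> 0.
  by apply/funext => x; have [-> _] := derive_affine f (E' x); rewrite derive0.
exact: Ck_cst.
Qed.

End CkAffine.

(** * Charts, smooth functions and tangent vectors *)

Section ChartTopology.
Variables (R : realType) (M : topologicalType) (d : nat).
Implicit Types (c : chart R M d) (U : set M).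

Lemma cinv_continuous c p : is_chart c -> dom c p ->
  {for cmap c p, continuous (cinv c)}.
Proof.
move=> hc dp; have := cinv_cont hc.
rewrite continuous_open_subspace; last exact: image_open.
by apply; apply/mem_set; exists p.
Qed.

Lemma cmap_continuous c p : is_chart c -> dom c p -> {for p, continuous (cmap c)}.
Proof.
move=> hc dp; have := cmap_cont hc.
rewrite continuous_open_subspace; last exact: dom_open.
by apply; apply/mem_set.
Qed.

Lemma chart_image_open c U : is_chart c -> open U -> open (cmap c @` (U `&` dom c)).
Proof.
move=> hc oU; rewrite openE => _ [p [Up dp] <-].
have /(_ U) cU := cinv_continuous hc dp.
have : nbhs (cinv c (cmap c p)) U.
  by rewrite (cmapK hc dp); exact: open_nbhs_nbhs.
move=> /cU UU; have {}UU : \forall x \near cmap c p, U (cinv c x) by [].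
have im : nbhs (cmap c p) (cmap c @` dom c).
  by apply: open_nbhs_nbhs; split; [exact: image_open|exists p].
suff : nbhs (cmap c p) (cmap c @` (U `&` dom c)) by [].
have H := @filterI _ _ (nbhs_filter (cmap c p)) _ _ UU im.
apply: (@filterS _ _ (nbhs_filter (cmap c p)) _ _ _ H) => x [Ux [q dq qx]];
  exists q => //; split=> //.
by move: Ux; rewrite /= -qx (cmapK hc dq).
Qed.

Lemma near_cinv c p (P : M -> Prop) : is_chart c -> dom c p ->
  (\forall q \near p, P q) -> \forall x \near cmap c p, P (cinv c x).
Proof.
move=> hc dp Pp; apply: (cinv_continuous hc dp).
by rewrite (cmapK hc dp).
Qed.

Lemma near_cmapK c p : is_chart c -> dom c p ->
  \forall x \near cmap c p, dom c (cinv c x) /\ cmap c (cinv c x) = x.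
Proof.
move=> hc dp; apply: filterS (open_nbhs_nbhs (conj (image_open hc) _)).
  by move=> _ [q dq <-]; rewrite (cmapK hc dq).
by exists p.
Qed.

End ChartTopology.

Section SmoothFunctions.
Variables (R : realType) (M : topologicalType) (d : nat) (A : set (chart R M d)).
Hypothesis hA : forall c, A c -> is_chart c.
Implicit Types (U V : set M) (f h : M -> R) (p q : M).

Lemma smooth_sub U V f : U `<=` V -> smooth A V f -> smooth A U f.
Proof.
move=> UV sf c Ac k; apply: Ck_sub (sf c Ac k).
by move=> x [q [Uq dq] <-]; exists q => //; split=> //; exact: UV.
Qed.

Lemma smooth_ext U f h : open U -> (forall q, U q -> f q = h q) ->
  smooth A U f -> smooth A U h.
Proof.
move=> oU fh sf c Ac k; have hc := hA Ac.
apply: Ck_ext (chart_image_open hc oU) _ (sf c Ac k) => _ [q [Uq dq] <-].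
by rewrite /= (cmapK hc dq) fh.
Qed.

Lemma smooth_cst U (a : R) : smooth A U (fun=> a).
Proof. by move=> c Ac k; exact: Ck_cst. Qed.

Lemma smoothD U f h : open U -> smooth A U f -> smooth A U h ->
  smooth A U (fun q => f q + h q).
Proof.
by move=> oU sf sh c Ac k; apply: CkD (chart_image_open (hA Ac) oU) (sf c Ac k)
  (sh c Ac k).
Qed.

Lemma smoothM U f h : open U -> smooth A U f -> smooth A U h ->
  smooth A U (fun q => f q * h q).
Proof.
by move=> oU sf sh c Ac k; apply: CkM (chart_image_open (hA Ac) oU) (sf c Ac k)
  (sh c Ac k).
Qed.

Lemma smoothV U f : open U -> (forall q, U q -> f q != 0) -> smooth A U f ->
  smooth A U (fun q => (f q)^-1).
Proof.
move=> oU f0 sf c Ac k; apply: CkV (chart_image_open (hA Ac) oU) _ (sf c Ac k).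
by move=> _ [q [Uq dq] <-] /=; rewrite (cmapK (hA Ac) dq) f0.
Qed.

Lemma smoothN U f : open U -> smooth A U f -> smooth A U (fun q => - f q).
Proof.
move=> oU sf; apply: (smooth_ext oU _ (smoothM oU (smooth_cst U (-1)) sf)).
by move=> q _; rewrite mulN1r.
Qed.

Lemma smooth_near_ext p f h : {near p, f =1 h} -> smooth_near A p f ->
  smooth_near A p h.
Proof.
rewrite /prop_near1 nbhsE => -[V [oV Vp] fh] [U [oU Up sf]].
exists (U `&` V); split=> //; first exact: openI.
apply: (smooth_ext _ _ (smooth_sub _ sf)) => [|q [_ /fh]//|]; first exact: openI.
by move=> q [].
Qed.

Lemma smooth_near2 p f h : smooth_near A p f -> smooth_near A p h ->
  exists U, [/\ open U, U p, smooth A U f & smooth A U h].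
Proof.
move=> [U [oU Up sf]] [V [oV Vp sh]]; exists (U `&` V); split=> //.
- exact: openI.
- by apply: smooth_sub sf => q [].
- by apply: smooth_sub sh => q [].
Qed.

Lemma smooth_near_differentiable c p f : A c -> dom c p -> smooth_near A p f ->
  differentiable (f \o cinv c) (cmap c p).
Proof.
move=> Ac dp [U [oU Up sf]].
by apply: smooth_differentiable (chart_image_open (hA Ac) oU) (sf c Ac) _; exists p.
Qed.

Lemma smooth_continuous U f p : open U -> smooth A U f -> U p ->
  (exists2 c, A c & dom c p) -> {for p, continuous f}.
Proof.
move=> oU sf Up [c Ac dp]; have hc := hA Ac.
have fc : {for cmap c p, continuous (f \o cinv c)}.
  by apply: (sf c Ac 0%N); exists p.
have := @continuous_comp _ _ _ (cmap c) (f \o cinv c) p (cmap_continuous hc dp) fc.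
rewrite /prop_for /continuous_at /= (cmapK hc dp); apply: cvg_trans.
apply: near_eq_cvg; apply: filterS (open_nbhs_nbhs (conj (dom_open hc) dp)) => q dq.
by rewrite /= (cmapK hc dq).
Qed.

End SmoothFunctions.

Section TangentVectors.
Variables (R : realType) (M : topologicalType) (d : nat) (A : set (chart R M d)).
Hypothesis hA : forall c, A c -> is_chart c.
Hypothesis hcover : forall p, exists2 c, A c & dom c p.
Implicit Types (U V : set M) (f h : M -> R) (p q : M) (v : (M -> R) -> R).
Implicit Types (X Y : M -> (M -> R) -> R).

Lemma sum_vectorE (I : Type) (r : seq I) (P : pred I) (F : I -> (M -> R) -> R) f :
  (\sum_(i <- r | P i) F i) f = \sum_(i <- r | P i) F i f.
Proof. by rewrite fct_sumE. Qed.

Lemma coord_vectorE c i p f : smooth_near A p f ->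
  coord_vector A c i p f = 'D_(delta_mx 0 i) (f \o cinv c) (cmap c p).
Proof. by rewrite /coord_vector => /asboolP ->. Qed.

Lemma coord_vector0 c i p f : ~ smooth_near A p f -> coord_vector A c i p f = 0.
Proof. by rewrite /coord_vector => /asboolPn /negbTE ->. Qed.

Lemma coord_vector_loc c i p f h : is_chart c -> dom c p -> {near p, f =1 h} ->
  coord_vector A c i p f = coord_vector A c i p h.
Proof.
move=> hc dp fh; have [sf|nf] := pselect (smooth_near A p f).
  have sh := smooth_near_ext hA fh sf; rewrite !coord_vectorE //.
  by apply: near_eq_derive; exact: near_cinv fh.
rewrite !coord_vector0 // => sh; apply: nf; apply: smooth_near_ext sh => //.
by apply: filterS fh => q /=.
Qed.

(** Inherited from the convention on coordinate vectors. It makes an equality of vectors, as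
    operators on all functions, recoverable from lifts to M x R. *)
Lemma tangent_out p v f : tangent A p v -> ~ smooth_near A p f -> v f = 0.
Proof.
move=> tv nf; have [c Ac dp] := hcover p; have [w ->] := tv c Ac dp.
by rewrite sum_vectorE big1 // => i _; rewrite -[LHS]/(_ * _) coord_vector0 ?mulr0.
Qed.

Lemma tangent_near p v f h : tangent A p v -> {near p, f =1 h} -> v f = v h.
Proof.
move=> tv fh; have [c Ac dp] := hcover p; have [w ->] := tv c Ac dp.
rewrite !sum_vectorE; apply: eq_bigr => i _.
by congr (_ * _); apply: coord_vector_loc => //; exact: hA.
Qed.

Lemma tangent_loc U p v f h : open U -> U p -> tangent A p v ->
  (forall q, U q -> f q = h q) -> v f = v h.
Proof.
move=> oU Up tv fh; apply: (tangent_near tv).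
by apply: filterS fh _; exact: open_nbhs_nbhs.
Qed.

Lemma tangent_lin p v (a : R) f h : tangent A p v -> smooth_near A p f ->
  smooth_near A p h -> v (fun q => a * f q + h q) = a * v f + v h.
Proof.
move=> tv sf sh; have [c Ac dp] := hcover p; have [w ->] := tv c Ac dp.
have sfh : smooth_near A p (fun q => a * f q + h q).
  have [U [oU Up sf' sh']] := smooth_near2 sf sh; exists U; split=> //.
  by apply: smoothD => //; apply: smoothM => //; exact: smooth_cst.
rewrite !sum_vectorE mulr_sumr -big_split /=; apply: eq_bigr => i _.
rewrite -![(_ *: _) _]/(_ * _) !coord_vectorE // mulrCA -mulrDr; congr (_ * _).
have df := smooth_near_differentiable hA Ac dp sf.
have dh := smooth_near_differentiable hA Ac dp sh.
rewrite -[LHS]/('D_(delta_mx 0 i) ((a \*: (f \o cinv c)) + (h \o cinv c)) (cmap c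
  p)).
rewrite deriveD ?deriveZ //; try exact: diff_derivable.
by apply: derivableZ; exact: diff_derivable.
Qed.

Lemma tangent_Leibniz p v f h : tangent A p v -> smooth_near A p f ->
  smooth_near A p h -> v (fun q => f q * h q) = f p * v h + h p * v f.
Proof.
move=> tv sf sh; have [c Ac dp] := hcover p; have [w ->] := tv c Ac dp.
have sfh : smooth_near A p (fun q => f q * h q).
  have [U [oU Up sf' sh']] := smooth_near2 sf sh; exists U; split=> //.
  exact: smoothM.
rewrite !sum_vectorE !mulr_sumr -big_split /=; apply: eq_bigr => i _.
rewrite -![(_ *: _) _]/(_ * _) !coord_vectorE //.
rewrite [f p * _]mulrCA [h p * _]mulrCA -mulrDr; congr (_ * _).
have df := smooth_near_differentiable hA Ac dp sf.
have dh := smooth_near_differentiable hA Ac dp sh.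
rewrite -[LHS]/('D_(delta_mx 0 i) ((f \o cinv c) * (h \o cinv c)) (cmap c p)).
rewrite deriveM /=; try exact: diff_derivable.
by rewrite (cmapK (hA Ac) dp).
Qed.

Lemma smooth_near_cst p (a : R) : smooth_near A p (fun=> a).
Proof. by exists setT; split=> //; [exact: openT|exact: smooth_cst]. Qed.

(** Additivity gives v 0 = v 0 + v 0 and the Leibniz rule on 1 = 1 * 1 gives v 1 = v 1 + v 1; the
    constant a is a * 1 + 0. *)
Lemma tangent_cst p v (a : R) : tangent A p v -> v (fun=> a) = 0.
Proof.
move=> tv.
have := tangent_lin 1 tv (smooth_near_cst p 0) (smooth_near_cst p 0).
rewrite !mul1r !addr0 => /eqP; rewrite -subr_eq subrr => /eqP/esym v0.
have := tangent_Leibniz tv (smooth_near_cst p 1) (smooth_near_cst p 1).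
rewrite !mulr1 !mul1r => /eqP; rewrite -subr_eq subrr => /eqP/esym v1.
have := tangent_lin a tv (smooth_near_cst p 1) (smooth_near_cst p 0).
by rewrite v0 v1 mulr0 !addr0 mulr1.
Qed.

Lemma tangentN_fun p v f : tangent A p v -> smooth_near A p f ->
  v (fun q => - f q) = - v f.
Proof.
move=> tv sf; have := tangent_lin (-1) tv sf (smooth_near_cst p 0).
rewrite (tangent_cst 0 tv) mulN1r addr0 => <-; congr (v _).
by apply/funext => q; rewrite mulN1r addr0.
Qed.

Lemma tangentD_fun p v f h : tangent A p v -> smooth_near A p f ->
  smooth_near A p h -> v (fun q => f q + h q) = v f + v h.
Proof.
move=> tv sf sh; have := tangent_lin 1 tv sf sh.
rewrite mul1r => <-; congr (v _); by apply/funext => q; rewrite mul1r.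
Qed.

Lemma smooth_nearN p f : smooth_near A p f -> smooth_near A p (fun q => - f q).
Proof. by move=> [U [oU Up sf]]; exists U; split=> //; exact: smoothN. Qed.

Lemma tangentB_fun p v f h : tangent A p v -> smooth_near A p f ->
  smooth_near A p h -> v (fun q => f q - h q) = v f - v h.
Proof.
by move=> tv sf sh; rewrite (tangentD_fun tv sf (smooth_nearN sh)) (tangentN_fun
  tv sh).
Qed.

Lemma tangent_comb p (a : R) u v : tangent A p u -> tangent A p v ->
  tangent A p (a *: u + v).
Proof.
move=> tu tv c Ac dp; have [w ->] := tu c Ac dp; have [w' ->] := tv c Ac dp.
exists (fun i => a * w i + w' i); rewrite scaler_sumr -big_split /=.
by apply: eq_bigr => i _; rewrite scalerDl scalerA.
Qed.

Lemma tangent0 p : tangent A p 0.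
Proof. by move=> c Ac dp; exists (fun=> 0); rewrite big1 // => i _;
  rewrite scale0r. Qed.

Lemma tangentZ p (a : R) v : tangent A p v -> tangent A p (a *: v).
Proof. by move=> tv; have := tangent_comb a tv (@tangent0 p); rewrite addr0. Qed.

Lemma tangentD p u v : tangent A p u -> tangent A p v -> tangent A p (u + v).
Proof. by move=> tu tv; rewrite -[u]scale1r; exact: tangent_comb. Qed.

Lemma tangentN p v : tangent A p v -> tangent A p (- v).
Proof. by rewrite -scaleN1r; exact: tangentZ. Qed.

Lemma tangentB p u v : tangent A p u -> tangent A p v -> tangent A p (u - v).
Proof. by move=> tu tv; apply: tangentD => //; exact: tangentN. Qed.

Lemma tangent_sum p (I : Type) (r : seq I) (P : pred I) (F : I -> (M -> R) -> R) :
  (forall i, P i -> tangent A p (F i)) -> tangent A p (\sum_(i <- r | P i) F i).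
Proof. by move=> tF; elim/big_rec: _ => [|i v Pi tv];
  [exact: tangent0|apply: tangentD; [exact: tF|]]. Qed.

Lemma vfield_sub U V X : U `<=` V -> vfield A V X -> vfield A U X.
Proof.
move=> UV [tX sX]; split=> [p /UV /tX//|W f oW WU sf].
by apply: sX => // q /WU /UV.
Qed.

Lemma vfield_comb U f X Y : open U -> smooth A U f -> vfield A U X -> vfield A U
  Y ->
  vfield A U (fun q => f q *: X q + Y q).
Proof.
move=> oU sf [tX sX] [tY sY]; split=> [p Up|V h oV VU sh].
  by apply: tangent_comb; [exact: tX|exact: tY].
apply: smoothD => //; last exact: sY.
apply: (smoothM hA oV _ (sX V h oV VU sh)).
exact: smooth_sub VU sf.
Qed.

Lemma vfield0 U : vfield A U (fun=> 0).
Proof. by split=> [p _|V h oV VU sh]; [exact: tangent0|exact: smooth_cst]. Qed.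

Lemma vfield_ext U X Y : open U -> (forall q, U q -> X q = Y q) ->
  vfield A U X -> vfield A U Y.
Proof.
move=> oU XY [tX sX]; split=> [p Up|V h oV VU sh]; first by rewrite -XY //;
  exact: tX.
by apply: smooth_ext (sX V h oV VU sh) => // q /VU /XY ->.
Qed.

Lemma vfieldZ U f X : open U -> smooth A U f -> vfield A U X ->
  vfield A U (fun q => f q *: X q).
Proof.
move=> oU sf vX; apply: (vfield_ext oU _ (vfield_comb oU sf vX (vfield0 U))).
by move=> q _; rewrite addr0.
Qed.

Lemma vfieldD U X Y : open U -> vfield A U X -> vfield A U Y ->
  vfield A U (fun q => X q + Y q).
Proof.
move=> oU vX vY; have := vfield_comb oU (@smooth_cst _ _ _ A U 1) vX vY.
apply: vfield_ext => //.
by move=> q _; rewrite scale1r.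
Qed.

Lemma vfieldN U X : open U -> vfield A U X -> vfield A U (fun q => - X q).
Proof.
move=> oU vX; have := vfieldZ oU (@smooth_cst _ _ _ A U (-1)) vX.
apply: vfield_ext => //.
by move=> q _; rewrite scaleN1r.
Qed.

Lemma vfieldB U X Y : open U -> vfield A U X -> vfield A U Y ->
  vfield A U (fun q => X q - Y q).
Proof. by move=> oU vX vY; apply: (vfieldD oU vX (vfieldN oU vY)). Qed.

Lemma vfield_sum U (I : Type) (r : seq I) (P : pred I) (F : I -> M -> (M -> R) ->
  R) :
  open U -> (forall i, P i -> vfield A U (F i)) ->
  vfield A U (fun q => \sum_(i <- r | P i) F i q).
Proof.
move=> oU vF; elim: r => [|i r IH].
  by apply: (vfield_ext oU _ (vfield0 U)) => q _; rewrite big_nil.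
case Pi: (P i); last first.
  by apply: (vfield_ext oU _ IH) => q _; rewrite big_cons Pi.
apply: (vfield_ext oU _ (vfieldD oU (vF i Pi) IH)) => q _.
by rewrite big_cons Pi.
Qed.

End TangentVectors.

(** * The product with a line *)

Lemma continuous_row (R : realType) (T : topologicalType) d (Phi : T -> 'rV[R]_d)
  x :
  (forall j, {for x, continuous (fun y => Phi y 0 j)}) -> {for x, continuous Phi}.
Proof.
move=> H; apply/cvgrPdist_le => e e0.
have K : \forall y \near x, forall j : 'I_d, `|Phi x 0 j - Phi y 0 j| <= e.
  apply: (@filter_forall _ _ _ (nbhs x)) => j.
  by have /cvgrPdist_le /(_ e e0) := H j.
apply: filterS K => y K; apply: normr_row_le (ltW e0) _ => j.
by rewrite !mxE.
Qed.

Lemma continuous_pair (T U V : topologicalType) (f : T -> U) (g : T -> V) x :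
  {for x, continuous f} -> {for x, continuous g} ->
  {for x, continuous (fun y => (f y, g y))}.
Proof. by move=> cf cg; exact: (cvg_pair cf cg). Qed.

Lemma continuous_coord (R : realType) d (j : 'I_d) :
  continuous (fun x : 'rV[R]_d => x 0 j : R).
Proof. move=> x; exact: (differentiable_continuous (@differentiable_coord _ _ _ x
  0 j)). Qed.

Section LineRow.
Variables (R : realType) (d : nat).
Implicit Types (x : 'rV[R]_d) (t : R).

Definition line_row x t : 'rV[R]_(d + 1) := row_mx x (const_mx t).

Lemma line_rowK (y : 'rV[R]_(d + 1)) : line_row (lsubmx y) (y 0 (rshift d ord0))
  = y.
Proof.
rewrite -[RHS]hsubmxK; congr row_mx.
by apply/rowP => j; rewrite (ord1 j) !mxE.
Qed.

Lemma line_row_deltal x t i (h : R) :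
  line_row (h *: delta_mx 0 i + x) t = h *: delta_mx 0 (lshift 1 i) + line_row x t.
Proof.
apply/rowP => j; rewrite /line_row [RHS]mxE; case: (splitP j) => k jk.
  have -> : j = lshift 1 k by exact: val_inj.
  by rewrite !row_mxEl !mxE eq_lshift.
have -> : j = rshift d k by exact: val_inj.
by rewrite !row_mxEr !mxE eq_rlshift andbF mulr0 add0r.
Qed.

Lemma line_row_deltar x t (h : R) :
  line_row x (h *: 1 + t) = h *: delta_mx 0 (rshift d ord0) + line_row x t.
Proof.
apply/rowP => j; rewrite /line_row [RHS]mxE; case: (splitP j) => k jk.
  have -> : j = lshift 1 k by exact: val_inj.
  by rewrite !row_mxEl !mxE eq_lrshift andbF mulr0 add0r.
have -> : j = rshift d k by exact: val_inj.
by rewrite !row_mxEr !mxE eq_rshift (ord1 k).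
Qed.

Lemma line_row_continuous t : continuous (line_row ^~ t).
Proof.
move=> x; apply: continuous_row => j.
rewrite /line_row; case: (splitP j) => k jk.
  have -> : (fun y => row_mx y (const_mx t) 0 j) = (fun y : 'rV[R]_d => y 0 k).
    by apply/funext => y; rewrite -[j](_ : lshift 1 k = _) ?row_mxEl //;
      exact: val_inj.
  exact: continuous_coord.
have -> : (fun y : 'rV[R]_d => row_mx y (const_mx t) 0 j) = (fun=> t).
  apply/funext => y; rewrite -[j](_ : rshift d k = _) ?row_mxEr ?mxE //.
  exact: val_inj.
exact: cst_continuous.
Qed.

Lemma lsubmx_continuous : continuous (lsubmx : 'rV[R]_(d + 1) -> 'rV[R]_d).
Proof.
move=> x; apply: continuous_row => j.
have -> : (fun y : 'rV[R]_(d + 1) => lsubmx y 0 j) = (fun y => y 0 (lshift 1 j)).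
  by apply/funext => y; rewrite mxE.
exact: continuous_coord.
Qed.

(** The alternatives required by [Ck_affine]: directions of M are kept, the direction of the line is
    collapsed. *)
Lemma lsubmx_delta (i : 'I_(d + 1)) :
  (exists j, forall (y : 'rV[R]_(d + 1)) (h : R),
     lsubmx (h *: delta_mx 0 i + y) = h *: delta_mx 0 j + lsubmx y) \/
  (forall (y : 'rV[R]_(d + 1)) (h : R), lsubmx (h *: delta_mx 0 i + y) = lsubmx y).
Proof.
case: (splitP i) => j ij; [left; exists j|right] => y h; apply/rowP => k;
  rewrite !mxE.
  have -> : i = lshift 1 j by exact: val_inj.
  by rewrite eq_lshift.
have -> : i = rshift d j by exact: val_inj.
by rewrite eq_lrshift andbF mulr0 add0r.
Qed.

End LineRow.

Section LineAtlas.
Variables (R : realType) (M : topologicalType) (d : nat) (A : set (chart R M d)).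
Hypothesis hA : forall c, A c -> is_chart c.
Hypothesis hcover : forall p, exists2 c, A c & dom c p.
Implicit Types (c : chart R M d) (U V : set M) (O : set (M * R)) (f : M * R -> R).
Implicit Types (p : M) (t : R) (q : M * R) (h : M -> R).

Lemma fst_continuous_at q : {for q, continuous (fst : M * R -> M)}.
Proof. by apply: cvg_fst. Qed.

Lemma slice_continuous t : continuous (fun p : M => (p, t)).
Proof. by move=> p; apply: (@continuous_pair _ _ _ id (cst t));
  [exact: cvg_id|exact: cst_continuous]. Qed.

Lemma fiber_continuous p : continuous (fun t : R => (p, t)).
Proof. by move=> t; apply: (@continuous_pair _ _ _ (cst p) id);
  [exact: cst_continuous|exact: cvg_id]. Qed.

Lemma open_slice O t : open O -> open [set p | O (p, t)].
Proof. by move=> oO; apply: open_comp oO => p _; exact: slice_continuous. Qed.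

Lemma open_fst U : open U -> open [set q : M * R | U q.1].
Proof. by move=> oU; apply: open_comp oU => q _; exact: fst_continuous_at. Qed.

Lemma line_chart_is_chart c : is_chart c -> is_chart (line_chart c).
Proof.
move=> hc; have oD : open (dom (line_chart c)) by exact/open_fst/dom_open.
have im : cmap (line_chart c) @` dom (line_chart c) =
    lsubmx @^-1` (cmap c @` dom c).
  apply/seteqP; split=> [_ [q dq <-] /=|y [p dp py]].
    by rewrite row_mxKl; exists q.1.
  exists (p, y 0 (rshift d ord0)) => //=.
  by rewrite -[RHS]line_rowK /line_row py.
have oI : open (cmap (line_chart c) @` dom (line_chart c)).
  rewrite im; apply: open_comp (image_open hc) => y _; exact: lsubmx_continuous.
split=> //.
- move=> [p t] /= dp; rewrite row_mxKl (cmapK hc dp); congr pair.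
  by rewrite row_mxEr mxE.
- rewrite continuous_open_subspace // => q /set_mem dq.
  apply: continuous_row => j /=; case: (splitP j) => k jk.
    have -> : (fun y : M * R => row_mx (cmap c y.1) (const_mx y.2) 0 j) =
        (fun y : M * R => (cmap c y.1) 0 k).
      by apply/funext => y; rewrite -[j](_ : lshift 1 k = _) ?row_mxEl //;
        exact: val_inj.
    apply: (@continuous_comp _ _ _ fst (fun p => cmap c p 0 k)) => //.
      exact: fst_continuous_at.
    apply: (@continuous_comp _ _ _ (cmap c) (fun x : 'rV[R]_d => x 0 k)).
      exact: cmap_continuous.
    exact: continuous_coord.
  have -> : (fun y : M * R => row_mx (cmap c y.1) (const_mx y.2) 0 j) = snd.
    apply/funext => y; rewrite -[j](_ : rshift d k = _) ?row_mxEr ?mxE //.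
    exact: val_inj.
  exact: cvg_snd.
- rewrite continuous_open_subspace // => y /set_mem; rewrite im => -[p dp py].
  apply: (@continuous_pair _ _ _ (fun y : 'rV[R]_(d + 1) => cinv c (lsubmx y))
    (fun y => y 0 (rshift d ord0) : R)); last exact: continuous_coord.
  apply: (@continuous_comp _ _ _ lsubmx (cinv c)); first exact: lsubmx_continuous.
  by rewrite -py; exact: cinv_continuous.
Qed.

Lemma line_atlas_charts (c : chart R (M * R)%type (d + 1)) : line_atlas A c ->
  is_chart c.
Proof. by move=> [c' Ac' <-]; exact/line_chart_is_chart/hA. Qed.

Lemma line_atlas_cover q : exists2 c, line_atlas A c & dom c q.
Proof.
by have [c Ac dq] := hcover q.1; exists (line_chart c) => //; exists c.
Qed.

Lemma comp_line_row f c t :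
  (fun p => f (p, t)) \o cinv c = (f \o cinv (line_chart c)) \o (line_row (d :=
    d) ^~ t).
Proof.
apply/funext => x /=; rewrite row_mxKl; congr (f (_, _)).
by rewrite row_mxEr mxE.
Qed.

Lemma comp_line_rowr f c (x : 'rV[R]_d) :
  (fun t => f (cinv c x, t)) = (f \o cinv (line_chart c)) \o line_row x.
Proof. by apply/funext => t; rewrite -[RHS]/(_ t);
  have /(congr1 (@^~ x)) := comp_line_row f c t. Qed.

Lemma derive_slice f c t (x : 'rV[R]_d) i :
  'D_(delta_mx 0 i) ((fun p => f (p, t)) \o cinv c) x =
  'D_(delta_mx 0 (lshift 1 i)) (f \o cinv (line_chart c)) (line_row x t).
Proof.
rewrite comp_line_row.
by have [] := @derive_affine R _ _ (line_row (d := d) ^~ t) (f \o cinv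
  (line_chart c)) x
  _ _ (line_row_deltal x t i).
Qed.

Lemma derive_fiber f c t (x : 'rV[R]_d) :
  derive1 (fun s => f (cinv c x, s)) t =
  'D_(delta_mx 0 (rshift d ord0)) (f \o cinv (line_chart c)) (line_row x t).
Proof.
rewrite derive1E comp_line_rowr.
by have [] := @derive_affine R _ _ (line_row x) (f \o cinv (line_chart c)) t
  _ _ (line_row_deltar x t).
Qed.

Lemma line_row_image O c t x : (cmap c @` ([set p | O (p, t)] `&` dom c)) x ->
  (cmap (line_chart c) @` (O `&` dom (line_chart c))) (line_row x t).
Proof. by move=> [p [Op dp] <-]; exists (p, t). Qed.

Lemma smooth_slice O f t : smooth (line_atlas A) O f ->
  smooth A [set p | O (p, t)] (fun p => f (p, t)).
Proof.
move=> sf c Ac k; rewrite comp_line_row.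
apply: (Ck_affine _ _ (@line_row_image O c t) (sf _ _ k)); last by exists c.
  exact: line_row_continuous.
by move=> i; left; exists (lshift 1 i) => x h; exact: line_row_deltal.
Qed.

(** In a product chart d/dt is the partial derivative in the last coordinate, so smoothness survives
    it before the restriction to the slice. *)
Lemma smooth_slice_derive O f t : smooth (line_atlas A) O f ->
  smooth A [set p | O (p, t)] (fun p => derive1 (fun s => f (p, s)) t).
Proof.
move=> sf c Ac k.
have -> : (fun p => derive1 (fun s => f (p, s)) t) \o cinv c =
  (fun y => 'D_(delta_mx 0 (rshift d ord0)) (f \o cinv (line_chart c)) y)
  \o (line_row (d := d) ^~ t).
  by apply/funext => x; rewrite /= derive_fiber.
apply: (Ck_affine _ _ (@line_row_image O c t)).
- exact: line_row_continuous.
- by move=> i; left; exists (lshift 1 i) => x h; exact: line_row_deltal.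
- by apply: smooth_derive; apply: sf; exists c.
Qed.

Lemma smooth_fst U h : smooth A U h -> smooth (line_atlas A) [set q | U q.1] (h
  \o fst).
Proof.
move=> sh _ [c Ac <-] k.
have -> : (h \o fst) \o cinv (line_chart c) = (h \o cinv c) \o lsubmx by [].
apply: (Ck_affine _ _ _ (sh c Ac k)) => [|i|_ [[p t] [Up dp] <-] /=].
- exact: lsubmx_continuous.
- exact: lsubmx_delta.
- by rewrite row_mxKl; exists p.
Qed.

Lemma smooth_snd : smooth (line_atlas A) setT snd.
Proof. by move=> _ [c Ac <-] k; exact: Ck_coord. Qed.

Lemma smooth_near_slice p t f : smooth_near (line_atlas A) (p, t) f ->
  smooth_near A p (fun p => f (p, t)).
Proof.
move=> [W [oW Wp sf]]; exists [set p | W (p, t)]; split=> //.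
  exact: open_slice.
exact: smooth_slice.
Qed.

Lemma smooth_near_slice_derive p t f : smooth_near (line_atlas A) (p, t) f ->
  smooth_near A p (fun p => derive1 (fun s => f (p, s)) t).
Proof.
move=> [W [oW Wp sf]]; exists [set p | W (p, t)]; split=> //.
  exact: open_slice.
exact: smooth_slice_derive.
Qed.

Lemma smooth_near_fst q h : smooth_near A q.1 h -> smooth_near (line_atlas A) q
  (h \o fst).
Proof.
move=> [U [oU Up sf]]; exists [set q | U q.1]; split=> //; first exact: open_fst.
exact: smooth_fst.
Qed.

Lemma smooth_near_snd q : smooth_near (line_atlas A) q snd.
Proof. by exists setT; split=> //; [exact: openT|exact: smooth_snd]. Qed.

Lemma smooth_near_open (N : topologicalType) e (B : set (chart R N e)) (g : N ->
  R) x :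
  smooth_near B x g -> \forall y \near x, smooth_near B y g.
Proof.
move=> [U [oU Ux sg]]; apply: filterS (open_nbhs_nbhs (conj oU Ux)) => y Uy.
by exists U.
Qed.

(** A vector of M commutes with d/dt: in a product chart this is the symmetry of the mixed
    derivatives in a coordinate of M and in t. *)
Lemma is_derive_tangent_slice p v f t : tangent A p v ->
  smooth_near (line_atlas A) (p, t) f ->
  is_derive t 1 (fun s => v (fun p => f (p, s)))
    (v (fun p => derive1 (fun s => f (p, s)) t)).
Proof.
move=> tv sf; have [c Ac dp] := hcover p; have [w ->] := tv c Ac dp.
have [W [oO Op sfO]] := sf.
pose F := f \o cinv (line_chart c); pose x := cmap c p.
have hL := line_chart_is_chart (hA Ac).
have AL : line_atlas A (line_chart c) by exists c.
have oI := chart_image_open hL oO.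
have Iy : (cmap (line_chart c) @` (W `&` dom (line_chart c))) (line_row x t).
  by exists (p, t).
have sF : smooth_on (cmap (line_chart c) @` (W `&` dom (line_chart c))) F by
  exact: sfO.
have nearE : {near t, (fun s => \sum_i w i * 'D_(delta_mx 0 (lshift 1 i)) F
  (line_row x s))
   =1 (fun s => (\sum_i w i *: coord_vector A c i p) (fun p => f (p, s)))}.
  (* [coord_vector] is 0 on functions that are not smooth, so its coordinate formula is available at
     s only once f is smooth near (p, s). *)
  have K : \forall s \near t, smooth_near (line_atlas A) (p, s) f.
    exact: (@fiber_continuous p t _ (smooth_near_open sf)).
  apply: filterS K => s sfs; rewrite sum_vectorE; apply: eq_bigr => i _.
  rewrite -[RHS]/(_ * _) coord_vectorE ?derive_slice //; exact: smooth_near_slice.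
have H : is_derive t 1 (fun s => \sum_i w i * 'D_(delta_mx 0 (lshift 1 i)) F
  (line_row x s))
    (\sum_i w i * 'D_(delta_mx 0 (rshift d ord0))
       (fun y => 'D_(delta_mx 0 (lshift 1 i)) F y) (line_row x t)).
  have -> : (fun s => \sum_i w i * 'D_(delta_mx 0 (lshift 1 i)) F (line_row x s)) =
    \sum_i (fun s => w i * 'D_(delta_mx 0 (lshift 1 i)) F (line_row x s)).
    by apply/funext => s; rewrite fct_sumE.
  apply: is_derive_sum => i; apply: is_deriveZ.
  have [E D] := @derive_affine R _ _ (line_row x)
     (fun y => 'D_(delta_mx 0 (lshift 1 i)) F y) t _ _ (line_row_deltar x t).
  split; last exact: E.
  by apply: D; apply: smooth_derivable Iy; exact: smooth_derive.
have -> : (\sum_i w i *: coord_vector A c i p) (fun p => derive1 (fun s => f (p,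
  s)) t) =
    \sum_i w i * 'D_(delta_mx 0 (rshift d ord0))
       (fun y => 'D_(delta_mx 0 (lshift 1 i)) F y) (line_row x t).
  rewrite sum_vectorE; apply: eq_bigr => i _.
  rewrite -[LHS]/(_ * _) coord_vectorE; last exact: smooth_near_slice_derive.
  apply: (congr1 (fun z => w i * z)).
  apply: (etrans _ (esym (Schwarz (rshift d ord0) (lshift 1 i) oI (sF 2) Iy))).
  have -> : (fun p => derive1 (fun s => f (p, s)) t) \o cinv c =
     (fun y => 'D_(delta_mx 0 (rshift d ord0)) F y) \o (line_row (d := d) ^~ t).
    by apply/funext => z; rewrite /= derive_fiber.
  by have [] := @derive_affine R _ _ (line_row (d := d) ^~ t)
     (fun y => 'D_(delta_mx 0 (rshift d ord0)) F y) x _ _ (line_row_deltal x t i).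
case: H => D E; split; first exact: near_eq_derivable nearE D.
by rewrite -E; apply/esym; apply: near_eq_derive.
Qed.

End LineAtlas.

Lemma near_eq_differentiable (R : realType) (V : normedModType R) (f g : V -> R) x :
  {near x, f =1 g} -> differentiable f x -> differentiable g x.
Proof.
move=> fg df.
have gE : (g : V -> R^o) \o shift x = cst (g x) + ('d f x : V -> R^o) +o_ (0 : V)
  (id : V -> V).
  have /diff_locally/(@eqaddoP R V R V (nbhs_filter_on (0 : V))) H := df.
  apply/(@eqaddoP R V R V (nbhs_filter_on (0 : V))) => e e0.
  have K : \forall h \near (0 : V), f (h + x) = g (h + x).
    have C : h + x @[h --> (0 : V)] --> x.
      by rewrite -{2}[x]add0r; apply: cvgD; [exact: cvg_id|exact: cvg_cst].
    exact: C fg.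
  apply: filterS (filterI (H e e0) K) => h /= [].
  rewrite -![(_ - _) h]/(_ - _) /= => He fgh.
  by rewrite /cst -fgh -(nbhs_singleton fg).
have dE := diff_unique (diff_continuous df) gE.
by apply/diff_locallyP; rewrite dE; split => //; exact: diff_continuous df.
Qed.

(** * Transformation of coordinate vectors between compatible charts *)

Section ChangeOfChart.
Variables (R : realType) (N : topologicalType) (d : nat) (B : set (chart R N d)).
Variables (c c' : chart R N d) (q : N).
Hypotheses (hc : is_chart c) (hc' : is_chart c') (dq : dom c q) (dq' : dom c' q).
Hypothesis cc' : smooth_transition c c'.
Hypothesis diff_c' : forall f, smooth_near B q f ->
  differentiable (f \o cinv c') (cmap c' q).

Lemma transition_open : open (cmap c @` (dom c `&` dom c')).
Proof. by rewrite setIC; apply: chart_image_open (dom_open hc'). Qed.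

(** A complex chart need not lie in the atlas [B] that defines smoothness, so differentiability in
    [c'] is a hypothesis of the section. It holds when [c'] is an atlas chart; the first conclusion
    then transports it to the complex chart, which allows the change in the opposite direction. *)
Lemma change_of_chart f : smooth_near B q f ->
  differentiable (f \o cinv c) (cmap c q) /\
  forall v, 'D_v (f \o cinv c) (cmap c q) =
    \sum_j 'D_v (fun x => cmap c' (cinv c x) 0 j) (cmap c q) *
           'D_(delta_mx 0 j) (f \o cinv c') (cmap c' q).
Proof.
move=> sf; pose Phi := cmap c' \o cinv c.
have PhiE : Phi (cmap c q) = cmap c' q by rewrite /Phi /= cmapK.
have E : {near cmap c q, (f \o cinv c') \o Phi =1 f \o cinv c}.
  have : \forall x \near q, dom c' x by apply: open_nbhs_nbhs (conj (dom_open
    hc') dq').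
  move=> /(near_cinv hc dq); apply: filterS => x dx.
  by rewrite /Phi /= (cmapK hc' dx).
have dPhi j : differentiable (fun x => Phi x 0 j : R) (cmap c q).
  by apply: smooth_differentiable transition_open (cc' j) _; exists q.
have dF : differentiable (f \o cinv c') (Phi (cmap c q)) by rewrite PhiE;
  exact: diff_c'.
split=> [|v].
  have [D _] := chain_rule 0 dPhi dF.
  by apply: near_eq_differentiable E D.
have [_ D] := chain_rule v dPhi dF.
by rewrite -(near_eq_derive v E) D PhiE.
Qed.

Lemma coord_vector_change i : coord_vector B c i q =
  \sum_j 'D_(delta_mx 0 i) (fun x => cmap c' (cinv c x) 0 j) (cmap c q) *:
    coord_vector B c' j q.
Proof.
apply/funext => f; rewrite sum_vectorE; have [sf|nf] := pselect (smooth_near B q f).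
  rewrite coord_vectorE // (change_of_chart sf).2; apply: eq_bigr => j _.
  by rewrite -[RHS]/(_ * _) coord_vectorE.
rewrite coord_vector0 // big1 // => j _.
by rewrite -[LHS]/(_ * _) coord_vector0 ?mulr0.
Qed.

End ChangeOfChart.

(** * Vectors of M x R and their components on M and on the line *)

Section LiftedVectors.
Variables (R : realType) (M : topologicalType) (d : nat) (A : set (chart R M d)).
Hypothesis hA : forall c, A c -> is_chart c.
Hypothesis hcover : forall p, exists2 c, A c & dom c p.
Implicit Types (c : chart R M d) (f : M * R -> R).
Implicit Types (p : M) (t : R) (q : M * R) (h : M -> R).
Local Notation LA := (line_atlas A).
Local Notation push W := (fun h : M -> R => W (h \o fst) : R).

Lemma lift_vectorE q u f : smooth_near LA q f ->
  lift_vector A q u f = u (fun p => f (p, q.2)).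
Proof. by rewrite /lift_vector => /asboolP ->. Qed.

Lemma d_dtE q f : smooth_near LA q f ->
  d_dt A q f = derive1 (fun s => f (q.1, s)) q.2.
Proof. by rewrite /d_dt => /asboolP ->. Qed.

Lemma lift_coord c q i : A c -> dom c q.1 ->
  lift_vector A q (coord_vector A c i q.1) =
  coord_vector LA (line_chart c) (lshift 1 i) q.
Proof.
move=> Ac dq; apply/funext => f.
have [sf|nf] := pselect (smooth_near LA q f); last first.
  by rewrite coord_vector0 // /lift_vector; have /asboolPn/negbTE -> := nf.
rewrite lift_vectorE // !coord_vectorE ?derive_slice //.
by apply: smooth_near_slice => //; case: q sf {dq}.
Qed.

Lemma d_dt_coord c q : A c -> dom c q.1 ->
  d_dt A q = coord_vector LA (line_chart c) (rshift d ord0) q.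
Proof.
move=> Ac dq; apply/funext => f.
have [sf|nf] := pselect (smooth_near LA q f); last first.
  by rewrite coord_vector0 // /d_dt; have /asboolPn/negbTE -> := nf.
rewrite d_dtE // coord_vectorE //.
have := derive_fiber f c q.2 (cmap c q.1).
by rewrite (cmapK (hA Ac) dq).
Qed.

Lemma lift_lin q (a : R) u v :
  lift_vector A q (a *: u + v) = a *: lift_vector A q u + lift_vector A q v.
Proof.
apply/funext => f; rewrite -[RHS]/(_ * _ + _) /lift_vector.
by case: ifP => // _; rewrite mulr0 addr0.
Qed.

Lemma lift0 q : lift_vector A q 0 = 0.
Proof. by apply/funext => f; rewrite /lift_vector; case: ifP. Qed.

(** The condition on [u] makes both sides vanish when h is not smooth near the base point, whichever
    branch the lift takes on [h \o fst]. *)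
Lemma push_lift q u : (forall h, ~ smooth_near A q.1 h -> u h = 0) ->
  push (lift_vector A q u) = u.
Proof.
move=> hu; apply/funext => h.
have [sh|nh] := pselect (smooth_near A q.1 h).
  by rewrite lift_vectorE //; exact: smooth_near_fst.
by rewrite hu // /lift_vector; case: ifP => // _; exact: hu.
Qed.

Lemma push_d_dt q : push (d_dt A q) = 0.
Proof.
apply/funext => h; rewrite /d_dt; case: ifP => // _.
exact: (derive1_cst (h q.1)).
Qed.

Lemma d_dt_snd q : d_dt A q snd = 1.
Proof.
rewrite d_dtE; last exact: smooth_near_snd.
by rewrite derive1E (@derive_id R R).
Qed.

Lemma lift_snd q u : tangent A q.1 u -> lift_vector A q u snd = 0.
Proof.
move=> tu; rewrite lift_vectorE; last exact: smooth_near_snd.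
exact: (tangent_cst hA hcover q.2 tu).
Qed.

Lemma tangent_lift q u : tangent A q.1 u -> tangent LA q (lift_vector A q u).
Proof.
move=> tu _ [c Ac <-] dq; have [w ->] := tu c Ac dq.
pose w' (j : 'I_(d + 1)) := match fintype.split j with inl i => w i | inr _ => 0
  end.
exists w'; rewrite big_split_ord /= [X in _ + X]big1 ?addr0; last first.
  by move=> i _; rewrite /w' (unsplitK (inr i)) scale0r.
transitivity (\sum_i w i *: lift_vector A q (coord_vector A c i q.1)).
  elim/big_rec2: _ => [|i x y _ <-]; first exact: lift0.
  by rewrite lift_lin.
by apply: eq_bigr => i _; rewrite /w' (unsplitK (inl i)) lift_coord.
Qed.

Lemma tangent_d_dt q : tangent LA q (d_dt A q).
Proof.
move=> _ [c Ac <-] dq; exists (fun j => (j == rshift d ord0)%:R).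
rewrite (bigD1 (rshift d ord0)) //= eqxx scale1r big1 ?addr0;
  first exact: d_dt_coord.
by move=> j /negbTE ->; rewrite scale0r.
Qed.

End LiftedVectors.

(** * Riemannian and almost contact algebra *)

Section MetricAlgebra.
Variables (R : realType) (M : topologicalType) (d : nat) (A : set (chart R M d)).
Variables (g : M -> ((M -> R) -> R) -> ((M -> R) -> R) -> R).
Hypothesis hg : riemannian_metric A g.
Implicit Types (p : M) (u v w : (M -> R) -> R).

Lemma metricDl p u v w : tangent A p u -> tangent A p v -> tangent A p w ->
  g p (u + v) w = g p u w + g p v w.
Proof.
by move=> tu tv tw; have := metric_linear hg 1 tu tv tw; rewrite scale1r mul1r.
Qed.

Lemma metric0l p w : tangent A p w -> g p 0 w = 0.
Proof.
move=> tw; have := metricDl (@tangent0 _ _ _ A p) (@tangent0 _ _ _ A p) tw.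
by rewrite addr0 => /eqP; rewrite -subr_eq subrr => /eqP <-.
Qed.

Lemma metricZl p (a : R) u w : tangent A p u -> tangent A p w ->
  g p (a *: u) w = a * g p u w.
Proof.
move=> tu tw; have := metric_linear hg a tu (@tangent0 _ _ _ A p) tw.
by rewrite addr0 metric0l // addr0.
Qed.

Lemma metricNl p u w : tangent A p u -> tangent A p w -> g p (- u) w = - g p u w.
Proof. by move=> tu tw; rewrite -scaleN1r metricZl // mulN1r. Qed.

Lemma metricBl p u v w : tangent A p u -> tangent A p v -> tangent A p w ->
  g p (u - v) w = g p u w - g p v w.
Proof. by move=> tu tv tw; rewrite metricDl ?metricNl //; exact: tangentN. Qed.

Lemma metric_suml p (I : Type) (r : seq I) (F : I -> (M -> R) -> R) w :
  (forall i, tangent A p (F i)) -> tangent A p w ->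
  g p (\sum_(i <- r) F i) w = \sum_(i <- r) g p (F i) w.
Proof.
move=> tF tw; elim: r => [|i r IH]; first by rewrite !big_nil metric0l.
by rewrite !big_cons metricDl ?IH //; exact: tangent_sum.
Qed.

Lemma metricDr p u v w : tangent A p u -> tangent A p v -> tangent A p w ->
  g p w (u + v) = g p w u + g p w v.
Proof.
move=> tu tv tw; rewrite (Defs.metric_sym hg tw (tangentD tu tv)) metricDl //.
by rewrite !(Defs.metric_sym hg tw).
Qed.

Lemma metricZr p (a : R) u w : tangent A p u -> tangent A p w ->
  g p w (a *: u) = a * g p w u.
Proof.
by move=> tu tw; rewrite (Defs.metric_sym hg tw (tangentZ a tu)) metricZl //
  (Defs.metric_sym hg tw).
Qed.

Lemma metricNr p u w : tangent A p u -> tangent A p w -> g p w (- u) = - g p w u.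
Proof. by move=> tu tw; rewrite -scaleN1r metricZr // mulN1r. Qed.

Lemma metricBr p u v w : tangent A p u -> tangent A p v -> tangent A p w ->
  g p w (u - v) = g p w u - g p w v.
Proof. by move=> tu tv tw; rewrite metricDr ?metricNr //; exact: tangentN. Qed.

Lemma metric0r p w : tangent A p w -> g p w 0 = 0.
Proof. by move=> tw; rewrite (Defs.metric_sym hg tw (@tangent0 _ _ _ A p))
  metric0l. Qed.

Lemma metric_eq0 p v : tangent A p v -> g p v v = 0 -> v = 0.
Proof.
move=> tv v0; apply: contrapT => /(metric_pos hg tv).
by rewrite v0 ltxx.
Qed.

Lemma frame_expand (B : M -> ((M -> R) -> R) -> Prop) (U : set M) (k : nat)
    (E : 'I_k -> M -> (M -> R) -> R) p v :
  (forall q w, B q w -> tangent A q w) -> orthonormal_frame A g B U E -> U p -> B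
    p v ->
  v = \sum_i g p v (E i p) *: E i p.
Proof.
move=> BT hE Up Bv; have [a va] := frame_span hE Up Bv.
have tE i : tangent A p (E i p) by exact: (vfield_tangent (frame_vfield hE i)).
rewrite {1}va; apply: eq_bigr => i _; congr (_ *: _).
rewrite va metric_suml //; last by move=> j; exact: tangentZ.
rewrite (bigD1 i) //= metricZl // (frame_orthonormal hE) // eqxx mulr1.
rewrite big1 ?addr0 // => j ji.
by rewrite metricZl // (frame_orthonormal hE) // (negbTE ji) mulr0.
Qed.

End MetricAlgebra.

Section AlmostContactAlgebra.
Variables (R : realType) (M : topologicalType) (d : nat) (A : set (chart R M d)).
Variables (g : M -> ((M -> R) -> R) -> ((M -> R) -> R) -> R).
Variables (theta : M -> ((M -> R) -> R) -> ((M -> R) -> R)).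
Variables (xi : M -> (M -> R) -> R) (eta : M -> ((M -> R) -> R) -> R).
Hypothesis hg : riemannian_metric A g.
Hypothesis hacm : almost_contact_metric A g theta xi eta.
Implicit Types (p : M) (u v w : (M -> R) -> R).

Let txi p : tangent A p (xi p).
Proof. exact: (vfield_tangent (acm_xi hacm)). Qed.

Let tth p v : tangent A p v -> tangent A p (theta p v).
Proof. exact: (endo_tangent (acm_theta hacm)). Qed.

Lemma thetaDZ p (a : R) u v : tangent A p u -> tangent A p v ->
  theta p (a *: u + v) = a *: theta p u + theta p v.
Proof. exact: (endo_linear (acm_theta hacm)). Qed.

Lemma thetaD p u v : tangent A p u -> tangent A p v ->
  theta p (u + v) = theta p u + theta p v.
Proof. by move=> tu tv; have := thetaDZ 1 tu tv; rewrite !scale1r. Qed.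

Lemma theta_0 p : theta p 0 = 0.
Proof.
have := thetaD (@tangent0 _ _ _ A p) (@tangent0 _ _ _ A p).
by rewrite addr0 => /eqP; rewrite -subr_eq subrr => /eqP <-.
Qed.

Lemma thetaZ p (a : R) u : tangent A p u -> theta p (a *: u) = a *: theta p u.
Proof.
by move=> tu; have := thetaDZ a tu (@tangent0 _ _ _ A p); rewrite theta_0 !addr0.
Qed.

Lemma thetaN p u : tangent A p u -> theta p (- u) = - theta p u.
Proof. by move=> tu; rewrite -[- u]scaleN1r thetaZ // scaleN1r. Qed.

Lemma thetaB p u v : tangent A p u -> tangent A p v ->
  theta p (u - v) = theta p u - theta p v.
Proof. by move=> tu tv; rewrite thetaD ?thetaN //; exact: tangentN. Qed.

Lemma theta_sum p (I : Type) (r : seq I) (F : I -> (M -> R) -> R) :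
  (forall i, tangent A p (F i)) ->
  theta p (\sum_(i <- r) F i) = \sum_(i <- r) theta p (F i).
Proof.
move=> tF; elim: r => [|i r IH]; first by rewrite !big_nil theta_0.
by rewrite !big_cons thetaD ?IH //; exact: tangent_sum.
Qed.

Lemma etaDZ p (a : R) u v : tangent A p u -> tangent A p v ->
  eta p (a *: u + v) = a * eta p u + eta p v.
Proof. exact: (form_linear (acm_eta hacm)). Qed.

Lemma eta_0 p : eta p 0 = 0.
Proof.
have := etaDZ 1 (@tangent0 _ _ _ A p) (@tangent0 _ _ _ A p).
by rewrite scale1r mul1r addr0 => /eqP; rewrite -subr_eq subrr => /eqP <-.
Qed.

Lemma etaZ p (a : R) u : tangent A p u -> eta p (a *: u) = a * eta p u.
Proof. by move=> tu; have := etaDZ a tu (@tangent0 _ _ _ A p);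
  rewrite eta_0 !addr0. Qed.

(** Since theta^2 xi = 0, the formula for theta^2 at theta xi gives theta xi = a xi with a =
    eta(theta xi). Applying theta gives a theta xi = 0, then eta gives a^2 = 0. *)
Lemma theta_xi p : theta p (xi p) = 0.
Proof.
have t2 : theta p (theta p (xi p)) = 0.
  by rewrite (acm_theta2 hacm) // (acm_eta_xi hacm) scale1r addNr.
have := acm_theta2 hacm (tth (@txi p)); rewrite t2 theta_0 => /eqP.
rewrite eq_sym addrC subr_eq0 => /eqP E.
have F : eta p (theta p (xi p)) *: theta p (xi p) = 0.
  by have := congr1 (theta p) E; rewrite (thetaZ _ (@txi p)) t2.
have := congr1 (eta p) F; rewrite (etaZ _ (tth (@txi p))) eta_0 => /eqP.
by rewrite mulf_eq0 orbb => /eqP e0; rewrite -E e0 scale0r.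
Qed.

(** Two readings of theta^3 v: theta applied to theta^2 v is - theta v, while theta^2 applied to
    theta v is - theta v + eta(theta v) xi. *)
Lemma eta_theta p v : tangent A p v -> eta p (theta p v) = 0.
Proof.
move=> tv; have := acm_theta2 hacm (tth tv).
rewrite (acm_theta2 hacm tv) thetaD ?thetaN ?thetaZ ?theta_xi ?scaler0 ?addr0 //;
  [|exact: tangentN|exact: tangentZ].
move=> /eqP; rewrite -[X in X == _]addr0 (inj_eq (addrI _)) eq_sym => /eqP E.
have := congr1 (eta p) E; rewrite etaZ // (acm_eta_xi hacm) mulr1 => ->.
exact: eta_0.
Qed.

(** Compatibility with the metric, with xi as second argument and theta xi = 0. *)
Lemma eta_metric p v : tangent A p v -> eta p v = g p v (xi p).
Proof.
move=> tv; have := acm_metric hacm tv (@txi p).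
rewrite theta_xi (metric0r hg (tth tv)) (acm_eta_xi hacm) mulr1.
by move=> /eqP; rewrite eq_sym subr_eq0 => /eqP.
Qed.

(** Compatibility with the metric at (theta u, v), where the terms in eta vanish. *)
Lemma theta_skew p u v : tangent A p u -> tangent A p v ->
  g p (theta p u) v = - g p u (theta p v).
Proof.
move=> tu tv; have := acm_metric hacm (tth tu) tv.
rewrite (acm_theta2 hacm tu) eta_theta // mul0r subr0 => <-.
rewrite (metricDl hg) ?(metricNl hg) ?(metricZl hg) //; try exact: tth;
  [|exact: tangentN|exact: tangentZ].
rewrite (Defs.metric_sym hg (@txi p)) -?eta_metric ?eta_theta ?mulr0 ?addr0 //;
  exact: tth.
Qed.

Lemma metric_xi_xi p : g p (xi p) (xi p) = 1.
Proof. by rewrite -eta_metric ?(acm_eta_xi hacm). Qed.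

End AlmostContactAlgebra.

(** * Complex coordinates of a normal structure *)

Section NormalStructure.
Variables (R : realType) (M : topologicalType) (n : nat).
Let d := n.*2.+1.
Variable A : set (chart R M d).
Hypothesis hA : forall c, A c -> is_chart c.
Hypothesis hcover : forall p, exists2 c, A c & dom c p.
Variables (g : M -> ((M -> R) -> R) -> ((M -> R) -> R) -> R).
Variables (theta : M -> ((M -> R) -> R) -> ((M -> R) -> R)).
Variables (xi : M -> (M -> R) -> R) (eta : M -> ((M -> R) -> R) -> R).
Hypothesis hacm : almost_contact_metric A g theta xi eta.
Implicit Types (p : M) (t : R) (q : M * R) (h : M -> R) (f : M * R -> R).
Local Notation LA := (line_atlas A).
Local Notation push W := (fun h : M -> R => W (h \o fst) : R).
Local Notation J := (cone_J A theta xi eta).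

Lemma tangent_xi p : tangent A p (xi p).
Proof. exact: (vfield_tangent (acm_xi hacm)). Qed.

(** [theta] and [eta] are linear on tangent vectors only, hence the conditions on the M-components
    [push W] and [push W']. *)
Lemma cone_J_lin q (a : R) W W' : tangent A q.1 (push W) -> tangent A q.1 (push
  W') ->
  J q (a *: W + W') = a *: J q W + J q W'.
Proof.
move=> tW tW'; rewrite /cone_J.
have -> : push (a *: W + W') = a *: push W + push W' by [].
have -> : (a *: W + W') snd = a * W snd + W' snd by [].
rewrite (endo_linear (acm_theta hacm)) // (form_linear (acm_eta hacm)) //.
have -> : a *: theta q.1 (push W) + theta q.1 (push W') - (a * W snd + W' snd) *:
  xi q.1
  = a *: (theta q.1 (push W) - W snd *: xi q.1) + (theta q.1 (push W') - W' snd
    *: xi q.1).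
  by rewrite scalerBr scalerDl scalerA opprD addrACA.
rewrite lift_lin scalerDr scalerDl scalerA.
by rewrite addrACA.
Qed.

Lemma cone_J0 q : J q 0 = 0.
Proof.
rewrite /cone_J.
have -> : push (0 : (M * R -> R) -> R) = 0 by [].
by rewrite (theta_0 hacm) (eta_0 hacm) scale0r subr0 lift0 scale0r addr0.
Qed.

Lemma cone_J_sum q (I : Type) (r : seq I) (a : I -> R) (W : I -> (M * R -> R) ->
  R) :
  (forall i, tangent A q.1 (push (W i))) ->
  J q (\sum_(i <- r) a i *: W i) = \sum_(i <- r) a i *: J q (W i).
Proof.
move=> tW; elim: r => [|i r IH]; first by rewrite !big_nil cone_J0.
rewrite !big_cons cone_J_lin ?IH //.
have -> : push (\sum_(j <- r) a j *: W j) = \sum_(j <- r) a j *: push (W j).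
  by apply/funext => h; rewrite !fct_sumE.
by apply: tangent_sum => j _; exact: tangentZ.
Qed.

Lemma cone_J_lift q u : tangent A q.1 u ->
  J q (lift_vector A q u) = lift_vector A q (theta q.1 u) + eta q.1 u *: d_dt A q.
Proof.
move=> tu; rewrite /cone_J push_lift; last by move=> h; exact: (tangent_out hcover).
by rewrite lift_snd // scale0r subr0.
Qed.

Lemma cone_J_d_dt q : J q (d_dt A q) = - lift_vector A q (xi q.1).
Proof.
rewrite /cone_J push_d_dt (theta_0 hacm) (eta_0 hacm) d_dt_snd scale1r sub0r
  scale0r addr0.
by have := lift_lin A q (-1) (xi q.1) 0; rewrite addr0 lift0 addr0 !scaleN1r.
Qed.

Section ComplexChart.
Variable c : chart R (M * R)%type (d + 1).
Hypothesis hc : is_chart c.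
Hypothesis htrans : forall c', LA c' -> smooth_transition c c' /\
  smooth_transition c' c.
Hypothesis hJ : forall q, dom c q -> forall (k : nat) (a b : 'I_(d + 1)),
  a = k.*2 :> nat -> b = k.*2.+1 :> nat ->
  J q (coord_vector LA c a q) = coord_vector LA c b q /\
  J q (coord_vector LA c b q) = - coord_vector LA c a q.
Implicit Types a b : 'I_(d + 1).

Let hL := line_atlas_charts hA.

Lemma ccoord_smooth a : smooth LA (dom c) (fun q => cmap c q 0 a).
Proof.
move=> c' Lc'; rewrite setIC; exact: (htrans Lc').2.
Qed.

Lemma ccoord_near a q : dom c q -> smooth_near LA q (fun q => cmap c q 0 a).
Proof. by move=> dq; exists (dom c); split=> //; [exact: dom_open|exact:
  ccoord_smooth]. Qed.

Lemma ccoord_dual a b q : dom c q ->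
  coord_vector LA c a q (fun q => cmap c q 0 b) = (a == b)%:R.
Proof.
move=> dq; rewrite coord_vectorE; last exact: ccoord_near.
rewrite -(derive_coord a b (cmap c q)); apply: near_eq_derive.
by apply: filterS (near_cmapK hc dq) => x [_ /= ->].
Qed.

(** Tangency speaks of atlas charts only. The vector is expanded in an atlas chart [c0], whose
    coordinate vectors are rewritten in the complex chart; differentiability of smooth functions in
    the latter comes from a first change of chart, from [c] to [c0]. *)
Lemma tangent_expand q W : dom c q -> tangent LA q W ->
  W = \sum_a W (fun q => cmap c q 0 a) *: coord_vector LA c a q.
Proof.
move=> dq tW; have [c0 A0 d0] := line_atlas_cover hcover q.
have [w ->] := tW c0 A0 d0.
have diffc f : smooth_near LA q f -> differentiable (f \o cinv c) (cmap c q).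
  move=> sf; have diff0 f' : smooth_near LA q f' -> differentiable (f' \o cinv
    c0) (cmap c0 q).
    exact: (smooth_near_differentiable hL A0 d0).
  by have [] := @change_of_chart _ _ _ LA c c0 q hc (hL A0) dq d0 (htrans A0).1
    diff0 _ sf.
have E i : coord_vector LA c0 i q = \sum_a coord_vector LA c0 i q (fun q => cmap
  c q 0 a)
    *: coord_vector LA c a q.
  rewrite {1}(@coord_vector_change _ _ _ LA c0 c q (hL A0) hc d0 dq (htrans A0).2
    diffc i).
  apply: eq_bigr => a _; congr (_ *: _).
  by rewrite coord_vectorE //; exact: ccoord_near.
rewrite {1}(eq_bigr _ (fun i _ => congr1 (fun v => w i *: v) (E i))).
under eq_bigr do rewrite scaler_sumr.
rewrite exchange_big /=; apply: eq_bigr => a _.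
rewrite sum_vectorE scaler_suml; apply: eq_bigr => i _.
by rewrite scalerA.
Qed.

(** This supplies the side condition for the linearity of J. In a product chart the components along
    M push to coordinate vectors of M and the d/dt component pushes to 0. *)
Lemma push_ccoord a q : dom c q -> tangent A q.1 (push (coord_vector LA c a q)).
Proof.
move=> dq c0 A0 d0; pose L := line_chart c0.
have AL : LA L by exists c0.
have diffL f : smooth_near LA q f -> differentiable (f \o cinv L) (cmap L q).
  exact: (smooth_near_differentiable hL AL (d0 : dom L q)).
have := @coord_vector_change _ _ _ LA c L q hc (hL AL) dq d0 (htrans AL).1 diffL a.
set k := fun j => 'D_(delta_mx 0 a) (fun x => cmap L (cinv c x) 0 j) (cmap c q).
move=> E; exists (fun i => k (lshift 1 i)).
transitivity (push (\sum_j k j *: coord_vector LA L j q)); first by rewrite E.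
apply/funext => h; rewrite fct_sumE big_split_ord /=.
rewrite [X in _ + X]big1 ?addr0 => [|i _].
  rewrite fct_sumE; apply: eq_bigr => i _; rewrite -![(_ *: _) _]/(_ * _).
  congr (_ * _); rewrite -lift_coord //.
  have := @push_lift _ _ _ A q (coord_vector A c0 i q.1).
  by move=> /(_ (fun h => @coord_vector0 _ _ _ _ _ _ _ h))/(congr1 (@^~ h)).
rewrite -[LHS]/(_ * _); have -> : i = ord0 by rewrite ord1.
rewrite -d_dt_coord //.
by have /(congr1 (@^~ h)) /= -> := @push_d_dt _ _ _ A q; rewrite mulr0.
Qed.

(** The largest index d = 2n + 1 is odd, so every even index has a successor within range. *)
Lemma partner_subproof a : ((if odd a then a.-1 else a.+1) < d + 1)%N.
Proof.
case: ifP => oa; first by apply: leq_ltn_trans (leq_pred _) (ltn_ord a).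
have la : (a < d.+1)%N by rewrite -(addn1 d).
rewrite ltnS in la.
rewrite [X in (_ < X)%N]addn1 ltnS ltn_neqAle la andbT; apply/eqP => E.
by rewrite E /d /= odd_double in oa.
Qed.

(** The involution exchanging the real and imaginary parts of one complex coordinate, 2k and 2k +
    1. *)
Definition partner a : 'I_(d + 1) := Ordinal (partner_subproof a).

Lemma odd_partner a : odd (partner a) = ~~ odd a.
Proof.
rewrite /=; case oa: (odd a) => /=; last by rewrite oa.
by case: (nat_of_ord a) oa => //= k /negbTE.
Qed.

Lemma partnerK a : partner (partner a) = a.
Proof.
apply: val_inj; rewrite [LHS]/= -/(nat_of_ord (partner a)) odd_partner.
case oa: (odd a) => /=; rewrite oa //=.
by case: (nat_of_ord a) oa.
Qed.

(** The sign merges J(d/dx_k) = d/dy_k and J(d/dy_k) = - d/dx_k, so that later arguments need not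
    separate parities. *)
Lemma cone_J_ccoord a q : dom c q ->
  J q (coord_vector LA c a q) = (-1) ^+ odd a *: coord_vector LA c (partner a) q.
Proof.
move=> dq; case oa: (odd a); last first.
  rewrite expr0 scale1r; apply: (hJ dq (k := a./2) _ _).1.
    by rewrite -[LHS]odd_double_half oa.
  by rewrite /= oa -[in LHS](odd_double_half a) oa.
rewrite expr1 scaleN1r; apply: (hJ dq (k := a./2) _ _).2.
  by rewrite /= oa -[in LHS](odd_double_half a) oa.
by rewrite -[LHS]odd_double_half oa.
Qed.

Lemma cone_J_ccoord_fun a q W : dom c q -> tangent LA q W ->
  J q W (fun q => cmap c q 0 a) =
  - ((-1) ^+ odd a * W (fun q => cmap c q 0 (partner a))).
Proof.
move=> dq tW; rewrite {1}(tangent_expand dq tW) cone_J_sum; last by move=> b;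
  exact: push_ccoord.
rewrite fct_sumE (bigD1 (partner a)) //= big1 ?addr0 => [|b ba].
  rewrite -[LHS]/(_ * _) cone_J_ccoord // partnerK -[X in _ * X]/(_ * _).
  by rewrite ccoord_dual // eqxx mulr1 odd_partner; case: odd;
    rewrite !(expr0, expr1, mulr1, mul1r, mulrN1, mulN1r, opprK).
rewrite -[LHS]/(_ * _) cone_J_ccoord // -[X in _ * X]/(_ * _) ccoord_dual //.
case: eqP => [E|_]; last by rewrite !mulr0.
by rewrite -E partnerK eqxx in ba.
Qed.

(** The function y for which x + i y is holomorphic, x being the coordinate of index a: it is y_k
    for x_k, and - x_k for y_k, as y_k - i x_k = - i z_k. *)
Definition conj_coord a q : R := (-1) ^+ odd a * cmap c q 0 (partner a).

Lemma conj_coord_smooth a : smooth LA (dom c) (conj_coord a).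
Proof.
apply: (smoothM hL (dom_open hc)); first exact: smooth_cst.
exact: ccoord_smooth.
Qed.

Lemma tangent_conj_coord a q W : dom c q -> tangent LA q W ->
  W (conj_coord a) = (-1) ^+ odd a * W (fun q => cmap c q 0 (partner a)).
Proof.
move=> dq tW.
have s0 := @smooth_near_cst _ _ _ LA q 0.
have := tangent_lin hL (line_atlas_cover hcover) ((-1) ^+ odd a) tW (ccoord_near
  (partner a) dq) s0.
rewrite (tangent_cst hL (line_atlas_cover hcover) 0 tW) addr0 => <-.
by congr (W _); apply/funext => r; rewrite addr0.
Qed.

Lemma cone_J_coord a q W : dom c q -> tangent LA q W ->
  J q W (fun q => cmap c q 0 a) = - W (conj_coord a).
Proof. by move=> dq tW; rewrite cone_J_ccoord_fun // (tangent_conj_coord a dq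
  tW). Qed.

Lemma tangent_cone_J q W : tangent A q.1 (push W) -> tangent LA q (J q W).
Proof.
move=> tW; rewrite /cone_J; apply: tangentD; last exact/tangentZ/tangent_d_dt.
apply: tangent_lift => //; apply: tangentB; first exact: (endo_tangent (acm_theta
  hacm)).
exact/tangentZ/tangent_xi.
Qed.

Lemma cone_J_conj_coord a q W : dom c q -> tangent LA q W ->
  tangent A q.1 (push W) ->
  J q W (conj_coord a) = W (fun q => cmap c q 0 a).
Proof.
move=> dq tW tpW; rewrite (tangent_conj_coord a dq (tangent_cone_J tpW)).
rewrite cone_J_ccoord_fun // partnerK odd_partner.
by case: odd; rewrite !(expr0, expr1, mulr1, mul1r, mulrN1, mulN1r, mulrN, opprK,
  mulNr).
Qed.


(** The equations (J W) x = - W y and (J W) y = W x, written for W the lift of u (first two) and for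
    W = d/dt, where J(d/dt) = - xi (last two). *)
Lemma ccoord_CR a q u : dom c q -> tangent A q.1 u ->
  [/\ theta q.1 u (fun p => cmap c (p, q.2) 0 a)
        + eta q.1 u * derive1 (fun s => cmap c (q.1, s) 0 a) q.2
      = - u (fun p => conj_coord a (p, q.2)),
      theta q.1 u (fun p => conj_coord a (p, q.2))
        + eta q.1 u * derive1 (fun s => conj_coord a (q.1, s)) q.2
      = u (fun p => cmap c (p, q.2) 0 a),
      derive1 (fun s => conj_coord a (q.1, s)) q.2
      = xi q.1 (fun p => cmap c (p, q.2) 0 a) &
      derive1 (fun s => cmap c (q.1, s) 0 a) q.2
      = - xi q.1 (fun p => conj_coord a (p, q.2))].
Proof.
move=> dq tu.
have sx := ccoord_near a dq.
have sy : smooth_near LA q (conj_coord a).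
  by exists (dom c); split=> //; [exact: dom_open|exact: conj_coord_smooth].
have tL := tangent_lift tu; have tD := @tangent_d_dt _ _ _ A hA q.
have pL : tangent A q.1 (push (lift_vector A q u)).
  by rewrite push_lift // => h; exact: (tangent_out hcover).
have pD : tangent A q.1 (push (d_dt A q)) by rewrite push_d_dt; exact: tangent0.
have := cone_J_coord a dq tL; have := cone_J_conj_coord a dq tL pL.
have := cone_J_coord a dq tD; have := cone_J_conj_coord a dq tD pD.
rewrite !cone_J_lift // !cone_J_d_dt.
rewrite -![(- _) _]/(- _) -![(_ + _ *: _) _]/(_ + _ * _).
rewrite !lift_vectorE // !d_dtE // => E4 E3 E2 E1; split=> //.
by apply: oppr_inj; rewrite -E3.
Qed.

(** The hypothesis says that all components of u + m d/dt in the complex chart vanish. Pushing to M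
    then isolates u, and evaluating on [snd] isolates m. *)
Lemma ccoord_kill q u (m : R) : dom c q -> tangent A q.1 u ->
  (forall a, u (fun p => cmap c (p, q.2) 0 a)
     + m * derive1 (fun s => cmap c (q.1, s) 0 a) q.2 = 0) -> u = 0 /\ m = 0.
Proof.
move=> dq tu H; pose W := lift_vector A q u + m *: d_dt A q.
have tW : tangent LA q W.
  by apply: tangentD; [exact: tangent_lift|exact/tangentZ/tangent_d_dt].
have W0 : W = 0.
  rewrite (tangent_expand dq tW) big1 // => a _.
  rewrite -[W _]/(_ + m * _) lift_vectorE ?d_dtE ?H ?scale0r //; exact: ccoord_near.
split.
  have : push W = 0 by rewrite W0.
  have -> : push W = push (lift_vector A q u) + m *: push (d_dt A q) by [].
  rewrite push_lift ?push_d_dt ?scaler0 ?addr0 // => h; exact: (tangent_out hcover).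
have : W snd = 0 by rewrite W0.
by rewrite -[W _]/(_ + m * _) lift_snd // d_dt_snd mulr1 add0r.
Qed.

End ComplexChart.

(** The Cauchy-Riemann equations of h + i h' on M x R, applied to a vector X of M, after the
    t-derivatives of h and h' have been replaced by - xi h' and xi h. *)
Definition CR_pair p X h h' : Prop :=
  theta p X h = eta p X * xi p h' - X h' /\
  theta p X h' = X h - eta p X * xi p h.

Lemma tangent_theta p X : tangent A p X -> tangent A p (theta p X).
Proof. exact: (endo_tangent (acm_theta hacm)). Qed.

Hypothesis hnormal : normal A theta xi eta.

(** All that the sequel retains of normality. The pairs are the complex coordinates and their
    conjugates on the slice t = 0. Their t-derivative is the pair (- xi y, xi x), that is i times
    (xi x) + i (xi y), which explains why (xi x, xi y) solves the same equations. *)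
Lemma CR_functions p : exists U (u v : 'I_(d + 1) -> M -> R),
  [/\ open U, U p,
      forall a, smooth A U (u a) /\ smooth A U (v a),
      forall a (q : M) X, U q -> tangent A q X -> CR_pair q X (u a) (v a) /\
        CR_pair q X (fun r => xi r (u a)) (fun r => xi r (v a)) &
      forall V m, tangent A p V -> (forall a, V (u a) = m * xi p (v a)) ->
        V = 0 /\ m = 0].
Proof.
have [c [hc dc htrans hJ]] := hnormal (p, 0).
pose x a q := cmap c q 0 a; pose y := conj_coord c.
exists [set r | dom c (r, 0)], (fun a r => x a (r, 0)), (fun a r => y a (r, 0)).
have oU : open [set r | dom c (r, 0)] by exact/open_slice/dom_open.
have sx a := ccoord_smooth htrans a; have sy a := conj_coord_smooth hc htrans a.
split=> //.
- by move=> a; split; [exact: (smooth_slice 0 (sx a))|exact: (smooth_slice 0 (sy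
  a))].
- move=> a q X dq tX; have tT := tangent_theta tX; have tx := @tangent_xi q.
  (* Stated at every height t, not only at 0, because these equations are next differentiated in
     t. *)
  have E t : dom c (q, t) -> forall u, tangent A q u ->
      theta q u (fun r => x a (r, t)) = eta q u * xi q (fun r => y a (r, t))
        - u (fun r => y a (r, t)) /\
      theta q u (fun r => y a (r, t)) = u (fun r => x a (r, t))
        - eta q u * xi q (fun r => x a (r, t)).
    move=> dt u tu; have [E1 E2 E3 E4] := ccoord_CR hc htrans hJ a dt tu.
    rewrite -/(x a) -/(y a) /= in E1 E2 E3 E4.
    split; [rewrite E4 in E1|rewrite E3 in E2].
      by move/(canRL (addrK _)): E1 => ->; rewrite mulrN opprK addrC.
    by apply/eqP; rewrite eq_sym subr_eq; apply/eqP.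
  split; first exact: E dq X tX.
  have snx : smooth_near LA (q, 0) (x a).
    by exists (dom c); split; [exact: (dom_open hc)|exact: dq|exact: sx].
  have sny : smooth_near LA (q, 0) (y a).
    by exists (dom c); split; [exact: (dom_open hc)|exact: dq|exact: sy].
  have sxi h : smooth A [set r | dom c (r, 0)] h -> smooth_near A q (fun r => xi
    r h).
    move=> sh; exists [set r | dom c (r, 0)]; split=> //.
    exact: (vfield_smooth (acm_xi hacm) oU _ sh).
  have dE (r : M) : dom c (r, 0) ->
      derive1 (fun s => y a (r, s)) 0 = xi r (fun p => x a (p, 0)) /\
      derive1 (fun s => x a (r, s)) 0 = - xi r (fun p => y a (p, 0)).
    by move=> dr; have [_ _ ? ?] := ccoord_CR hc htrans hJ a dr (@tangent0 _ _ _
      A r).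
  have Ux v : tangent A q v ->
      v (fun r => derive1 (fun s => x a (r, s)) 0) = - v (fun r => xi r (fun r =>
        y a (r, 0))).
    move=> tv; rewrite -(tangentN_fun hA hcover tv (sxi _ (smooth_slice 0 (sy a)))).
    by apply: (tangent_loc hA hcover oU dq tv) => r /dE[].
  have Uy v : tangent A q v ->
      v (fun r => derive1 (fun s => y a (r, s)) 0) = v (fun r => xi r (fun r => x
        a (r, 0))).
    by move=> tv; apply: (tangent_loc hA hcover oU dq tv) => r /dE[].
  have nearE : \forall t \near (0 : R), dom c (q, t).
    by apply: (@fiber_continuous _ _ q 0); apply: open_nbhs_nbhs; split;
      [exact: dom_open|].
  have Dx v : tangent A q v -> is_derive (0 : R) (1 : R) (fun t => v (fun r => x
    a (r, t)))
      (- v (fun r => xi r (fun r => y a (r, 0)))).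
    by move=> tv; rewrite -(Ux v tv); exact: (is_derive_tangent_slice hA hcover
      tv snx).
  have Dy v : tangent A q v -> is_derive (0 : R) (1 : R) (fun t => v (fun r => y
    a (r, t)))
      (v (fun r => xi r (fun r => x a (r, 0)))).
    by move=> tv; rewrite -(Uy v tv); exact: (is_derive_tangent_slice hA hcover
      tv sny).
  have deriv_eq (f1 f2 : R -> R) d1 d2 : is_derive (0 : R) (1 : R) f1 d1 ->
      is_derive (0 : R) (1 : R) f2 d2 -> {near (0 : R), f1 =1 f2} -> d1 = d2.
    by move=> [_ <-] [_ <-]; exact: near_eq_derive.
  have N2 : {near (0 : R), (fun t => theta q X (fun r => y a (r, t))) =1
      (fun t => X (fun r => x a (r, t))) - (eta q X \*: (fun t => xi q (fun r =>
        x a (r, t))))}.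
    by apply: filterS nearE => t dt; have [_ ->] := E t dt X tX.
  have N1 : {near (0 : R), (fun t => theta q X (fun r => x a (r, t))) =1
      (eta q X \*: (fun t => xi q (fun r => y a (r, t)))) - (fun t => X (fun r =>
        y a (r, t)))}.
    by apply: filterS nearE => t dt; have [-> _] := E t dt X tX.
  (* Taking the t-derivative turns y into xi x and x into - xi y. The equation on theta X applied to
     xi x thus comes from the one on y, and the other one from the one on x. *)
  split.
    rewrite (deriv_eq _ _ _ _ (Dy _ tT)
      (is_deriveB (Dx _ tX) (is_deriveZ (eta q X) (Dx _ tx))) N2).
    by rewrite -[_ *: _]/(_ * _) mulrN opprK addrC.
  apply: oppr_inj; rewrite (deriv_eq _ _ _ _ (Dx _ tT)
      (is_deriveB (is_deriveZ (eta q X) (Dy _ tx)) (Dy _ tX)) N1).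
  by rewrite opprB.
(* As dx/dt = - xi y on the slice, [H] says that V + m d/dt annihilates every complex coordinate. *)
- move=> V m tV H.
  apply: (ccoord_kill hc htrans (dc : dom c (p, 0)) (u := V)) => // a.
  have [_ _ _ ->] := ccoord_CR hc htrans hJ a dc tV.
  by rewrite /= mulrN; apply/eqP; rewrite subr_eq0; apply/eqP; exact: H.
Qed.

End NormalStructure.

(** * The tensor identities of normality *)

Section Commutation.
Variables (R : realType) (M : topologicalType) (n : nat).
Let d := n.*2.+1.
Variable A : set (chart R M d).
Hypothesis hA : forall c, A c -> is_chart c.
Hypothesis hcover : forall p, exists2 c, A c & dom c p.
Variables (g : M -> ((M -> R) -> R) -> ((M -> R) -> R) -> R).
Variable nabla : M -> ((M -> R) -> R) -> (M -> (M -> R) -> R) -> ((M -> R) -> R).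
Variables (theta : M -> ((M -> R) -> R) -> ((M -> R) -> R)).
Variables (xi : M -> (M -> R) -> R) (eta : M -> ((M -> R) -> R) -> R).
Hypothesis hg : riemannian_metric A g.
Hypothesis hnabla : levi_civita A g nabla.
Hypothesis hacm : almost_contact_metric A g theta xi eta.
Hypothesis hnormal : normal A theta xi eta.
Implicit Types (p : M) (h : M -> R) (X Y Z : M -> (M -> R) -> R) (U W : set M).

Lemma vfield_theta U X : open U -> vfield A U X -> vfield A U (app theta X).
Proof. exact: (endo_smooth (acm_theta hacm)). Qed.

Lemma vfield_xi U : vfield A U xi.
Proof. exact: vfield_sub (acm_xi hacm). Qed.

Lemma vfield_cov U X Y : open U -> vfield A U X -> vfield A U Y ->
  vfield A U (cov nabla X Y).
Proof. exact: (conn_smooth (lc_connection hnabla)). Qed.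

Lemma bracketE U X Y p : open U -> vfield A U X -> vfield A U Y -> U p ->
  bracket A X Y p = cov nabla X Y p - cov nabla Y X p.
Proof. by move=> oU vX vY Up; rewrite (lc_torsion_free hnabla oU). Qed.

(** Tangency is read off the torsion-free condition: the bracket is a difference of two covariant
    derivatives. *)
Lemma tangent_bracket U X Y p : open U -> vfield A U X -> vfield A U Y -> U p ->
  tangent A p (bracket A X Y p).
Proof.
move=> oU vX vY Up; rewrite (bracketE oU) //.
by apply: tangentB; apply: (vfield_tangent (vfield_cov oU _ _)) Up.
Qed.

Lemma bracket_fun X Y p h : smooth_near A p h ->
  bracket A X Y p h = X p (fun q => Y q h) - Y p (fun q => X q h).
Proof. by rewrite /bracket => /asboolP ->. Qed.

Section TestFunctions.
Variables (W : set M) (h h' : M -> R) (p : M).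
Hypotheses (oW : open W) (Wp : W p) (sh : smooth A W h) (sh' : smooth A W h').
Hypothesis CRh : forall q v, W q -> tangent A q v -> CR_pair theta xi eta q v h h'.
Hypothesis CRxi : forall v, tangent A p v ->
  CR_pair theta xi eta p v (fun r => xi r h) (fun r => xi r h').

Let snh : smooth_near A p h. Proof. by exists W. Qed.
Let snh' : smooth_near A p h'. Proof. by exists W. Qed.

Let snX X k : vfield A W X -> smooth A W k -> smooth_near A p (fun q => X q k).
Proof. by move=> vX sk; exists W; split=> //; apply: (vfield_smooth vX). Qed.

Let sneta X : vfield A W X -> smooth_near A p (fun q => eta q (X q)).
Proof. by move=> vX; exists W; split=> //; apply: (form_smooth (acm_eta hacm)). Qed.

(** The equations of [CRh] hold on a neighbourhood of p, so they may be differentiated along Y; the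
    Leibniz rule splits the product eta(X) (xi h). *)
Lemma theta_field_derive X Y : vfield A W X -> vfield A W Y ->
  Y p (fun q => theta q (X q) h) =
    eta p (X p) * Y p (fun q => xi q h') + xi p h' * Y p (fun q => eta q (X q))
    - Y p (fun q => X q h') /\
  Y p (fun q => theta q (X q) h') =
    Y p (fun q => X q h)
    - (eta p (X p) * Y p (fun q => xi q h) + xi p h * Y p (fun q => eta q (X q))).
Proof.
move=> vX vY; have tY := vfield_tangent vY Wp; have vxi := vfield_xi W.
have sm k : smooth A W k -> smooth_near A p (fun q => eta q (X q) * xi q k).
  move=> sk; exists W; split=> //; apply: smoothM => //.
    exact: (form_smooth (acm_eta hacm)).
  exact: (vfield_smooth vxi).
split.
  transitivity (Y p (fun q => eta q (X q) * xi q h' - X q h')).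
    apply: (tangent_loc hA hcover oW Wp tY) => q Wq.
    by have [] := CRh Wq (vfield_tangent vX Wq).
  rewrite (tangentB_fun hA hcover tY (sm _ sh') (snX vX sh')).
  by rewrite (tangent_Leibniz hA hcover tY (sneta vX) (snX vxi sh')).
transitivity (Y p (fun q => X q h - eta q (X q) * xi q h)).
  apply: (tangent_loc hA hcover oW Wp tY) => q Wq.
  by have [] := CRh Wq (vfield_tangent vX Wq).
rewrite (tangentB_fun hA hcover tY (snX vX sh) (sm _ sh)).
by rewrite (tangent_Leibniz hA hcover tY (sneta vX) (snX vxi sh)).
Qed.

(** The vector on the left and the coefficient on the right are, up to a common sign, the M and d/dt
    components of the Nijenhuis tensor N_J(d/dt, X). Since dh/dt = - xi h', the identity says that
    N_J(d/dt, X) kills h; all second derivatives of h and h' cancel. *)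
Lemma Lie_xi_theta_fun X : vfield A W X ->
  (bracket A xi (app theta X) p - theta p (bracket A xi X p)) h =
  (xi p (fun q => eta q (X q)) - eta p (bracket A xi X p)) * xi p h'.
Proof.
move=> vX; have vxi := vfield_xi W; have tX := vfield_tangent vX Wp.
rewrite -[LHS]/(_ - _); have [-> _] := CRh Wp (tangent_bracket oW vxi vX Wp).
rewrite !bracket_fun // /app; have [-> _] := theta_field_derive vX vxi.
have [-> _] := CRxi tX; ring.
Qed.

(** Likewise for N_J on the lifts of X and Y, with J X = theta X + eta(X) d/dt: the vector on the
    left is its M-component, the coefficient on the right its d/dt-component, and the identity says
    that N_J(X, Y) kills h. *)
Lemma Nijenhuis_fun X Y : vfield A W X -> vfield A W Y ->
  let Q := bracket A (app theta X) Y p + bracket A X (app theta Y) p in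
  (bracket A (app theta X) (app theta Y) p - bracket A X Y p - theta p Q
   - (Y p (fun q => eta q (X q)) - X p (fun q => eta q (Y q))) *: xi p) h =
  (theta p (X p) (fun q => eta q (Y q)) - theta p (Y p) (fun q => eta q (X q))
   - eta p Q) * xi p h'.
Proof.
move=> vX vY Q; have vTX := vfield_theta oW vX; have vTY := vfield_theta oW vY.
have tX := vfield_tangent vX Wp; have tY := vfield_tangent vY Wp.
have tQ : tangent A p Q by apply: tangentD; apply: tangent_bracket oW _ _ Wp.
rewrite -[LHS]/(_ - _ - _ - _ * _); have [-> _] := CRh Wp tQ.
rewrite -[Q h']/(_ + _) !bracket_fun // /app.
have [_ ->] := theta_field_derive vX vY; have [_ ->] := theta_field_derive vY vX.
have [E1 _] := theta_field_derive vX vTY; have [E2 _] := theta_field_derive vY vTX.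
rewrite /app in E1 E2; rewrite E1 E2; have [_ ->] := CRxi tX;
  have [_ ->] := CRxi tY; ring.
Qed.

End TestFunctions.

(** The M-component of N_J(d/dt, X) = 0, that is L_xi theta = 0. *)
Lemma Lie_xi_theta U X p : open U -> vfield A U X -> U p ->
  bracket A xi (app theta X) p = theta p (bracket A xi X p).
Proof.
move=> oU vX Up; have [W [u [v [oW Wp suv CRuv kill]]]] := CR_functions hA hcover
  hacm hnormal p.
have oUW : open (U `&` W) by exact: openI.
have vX' : vfield A (U `&` W) X by apply: vfield_sub vX => q [].
have vT := vfield_theta oUW vX'; have vxi := vfield_xi (U `&` W).
have UWp : (U `&` W) p by [].
have [| |E _] := kill (bracket A xi (app theta X) p - theta p (bracket A xi X p))
  (xi p (fun q => eta q (X q)) - eta p (bracket A xi X p)).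
- apply: tangentB; first exact: tangent_bracket oUW _ _ UWp.
  by apply: (endo_tangent (acm_theta hacm)); exact: tangent_bracket oUW _ _ UWp.
- move=> a; have [su sv] := suv a.
  apply: (@Lie_xi_theta_fun (U `&` W)) => //.
  + by apply: smooth_sub su => q [].
  + by apply: smooth_sub sv => q [].
  + by move=> q w [_ Wq] tw; have [] := CRuv a q w Wq tw.
  + by move=> w tw; have [] := CRuv a p w Wp tw.
by apply/eqP; rewrite -subr_eq0 E.
Qed.

(** The d/dt-component of N_J(X, Y) = 0. Because eta vanishes on the image of theta, the left-hand
    side is d eta(theta X, Y) + d eta(X, theta Y). *)
Lemma deta_theta U X Y p : open U -> vfield A U X -> vfield A U Y -> U p ->
  theta p (X p) (fun q => eta q (Y q)) - theta p (Y p) (fun q => eta q (X q))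
   - eta p (bracket A (app theta X) Y p + bracket A X (app theta Y) p) = 0.
Proof.
move=> oU vX vY Up; have [W [u [v [oW Wp suv CRuv kill]]]] := CR_functions hA
  hcover hacm hnormal p.
have oUW : open (U `&` W) by exact: openI.
have vX' : vfield A (U `&` W) X by apply: vfield_sub vX => q [].
have vY' : vfield A (U `&` W) Y by apply: vfield_sub vY => q [].
have vTX := vfield_theta oUW vX'; have vTY := vfield_theta oUW vY'.
have UWp : (U `&` W) p by [].
pose Q := bracket A (app theta X) Y p + bracket A X (app theta Y) p.
have tQ : tangent A p Q by apply: tangentD; apply: tangent_bracket oUW _ _ UWp.
apply: (kill (bracket A (app theta X) (app theta Y) p - bracket A X Y p - theta p Q
   - (Y p (fun q => eta q (X q)) - X p (fun q => eta q (Y q))) *: xi p) _ _ _).2.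
- apply: tangentB; last by apply: tangentZ; exact: (vfield_tangent (acm_xi hacm)).
  apply: tangentB; last exact: (endo_tangent (acm_theta hacm)).
  by apply: tangentB; apply: tangent_bracket oUW _ _ UWp.
- move=> a; have [su sv] := suv a.
  apply: (@Nijenhuis_fun (U `&` W)) => //.
  + by apply: smooth_sub su => q [].
  + by apply: smooth_sub sv => q [].
  + by move=> q w [_ Wq] tw; have [] := CRuv a q w Wq tw.
  + by move=> w tw; have [] := CRuv a p w Wp tw.
Qed.

End Commutation.

(** * Commutation of the covariant derivative of xi with theta *)

Section Connection.
Variables (R : realType) (M : topologicalType) (d : nat) (A : set (chart R M d)).
Hypothesis hA : forall c, A c -> is_chart c.
Hypothesis hcover : forall p, exists2 c, A c & dom c p.
Variable nabla : M -> ((M -> R) -> R) -> (M -> (M -> R) -> R) -> ((M -> R) -> R).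
Hypothesis hn : connection A nabla.
Implicit Types (p : M) (v : (M -> R) -> R) (X Y Z : M -> (M -> R) -> R) (U : set M).

Lemma nabla_vecDZ U p (a : R) u v Y : open U -> U p -> tangent A p u -> tangent A
  p v ->
  vfield A U Y -> nabla p (a *: u + v) Y = a *: nabla p u Y + nabla p v Y.
Proof. exact: (conn_linear hn). Qed.

Lemma nabla_vecD U p u v Y : open U -> U p -> tangent A p u -> tangent A p v ->
  vfield A U Y -> nabla p (u + v) Y = nabla p u Y + nabla p v Y.
Proof.
by move=> oU Up tu tv vY; have := nabla_vecDZ 1 oU Up tu tv vY; rewrite !scale1r.
Qed.

Lemma nabla_vec0 U p Y : open U -> U p -> vfield A U Y -> nabla p 0 Y = 0.
Proof.
move=> oU Up vY; have := nabla_vecD oU Up (@tangent0 _ _ _ A p) (@tangent0 _ _ _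
  A p) vY.
by rewrite addr0 => /eqP; rewrite -subr_eq subrr => /eqP <-.
Qed.

Lemma nabla_vecZ U p (a : R) u Y : open U -> U p -> tangent A p u ->
  vfield A U Y -> nabla p (a *: u) Y = a *: nabla p u Y.
Proof.
move=> oU Up tu vY; have := nabla_vecDZ a oU Up tu (@tangent0 _ _ _ A p) vY.
by rewrite addr0 (nabla_vec0 oU Up vY) addr0.
Qed.

Lemma nabla_vecB U p u v Y : open U -> U p -> tangent A p u -> tangent A p v ->
  vfield A U Y -> nabla p (u - v) Y = nabla p u Y - nabla p v Y.
Proof.
move=> oU Up tu tv vY; rewrite (nabla_vecD oU Up tu (tangentN tv) vY).
by rewrite -[- v]scaleN1r (nabla_vecZ _ oU Up tv vY) scaleN1r.
Qed.

Lemma nabla_vec_sum U p (I : Type) (r : seq I) (v : I -> (M -> R) -> R) Y :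
  open U -> U p -> (forall i, tangent A p (v i)) -> vfield A U Y ->
  nabla p (\sum_(i <- r) v i) Y = \sum_(i <- r) nabla p (v i) Y.
Proof.
move=> oU Up tv vY; elim: r => [|i r IH].
  by rewrite !big_nil (nabla_vec0 oU Up vY).
by rewrite !big_cons (nabla_vecD oU Up _ _ vY) ?IH //; exact: tangent_sum.
Qed.

Lemma nabla0 p v : tangent A p v -> nabla p v (fun=> 0) = 0.
Proof.
move=> tv; have v0 : vfield A setT (fun=> 0) by exact: vfield0.
have := conn_leibniz hn openT (I : [set: M] p) tv (@smooth_cst _ _ _ A setT 1) v0
  v0.
have -> : (fun q : M => (1 : R) *: (0 : (M -> R) -> R) + 0) = fun=> 0.
  by apply/funext => q; rewrite scaler0 addr0.
rewrite (tangent_cst hA hcover 1 tv) scale0r addr0 scale1r.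
by move=> /eqP; rewrite -subr_eq subrr => /eqP <-.
Qed.

Lemma nabla_eq0 U p v Y : open U -> U p -> tangent A p v ->
  (forall q, U q -> Y q = 0) -> nabla p v Y = 0.
Proof.
move=> oU Up tv Y0; rewrite (conn_local hn oU Up tv (Z := fun=> 0)) //.
exact: nabla0.
Qed.

Lemma nabla_sumZ U p v (I : Type) (r : seq I) (f : I -> M -> R)
    (Y : I -> M -> (M -> R) -> R) : open U -> U p -> tangent A p v ->
  (forall i, smooth A U (f i)) -> (forall i, vfield A U (Y i)) ->
  nabla p v (fun q => \sum_(i <- r) f i q *: Y i q) =
  \sum_(i <- r) (f i p *: nabla p v (Y i) + v (f i) *: Y i p).
Proof.
move=> oU Up tv sf vY; elim: r => [|i r IH].
  by rewrite big_nil; apply: (nabla_eq0 oU Up tv) => q _; rewrite big_nil.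
have vS : vfield A U (fun q => \sum_(j <- r) f j q *: Y j q).
  by apply: (vfield_sum hA) => // j _; apply: (vfieldZ hA).
rewrite big_cons -IH -(conn_leibniz hn oU Up tv (sf i) (vY i) vS).
by apply: (conn_local hn oU Up tv) => q _; rewrite big_cons.
Qed.

End Connection.

Section CovariantDerivativeOfReebField.
Variables (R : realType) (M : topologicalType) (n : nat).
Let d := n.*2.+1.
Variable A : set (chart R M d).
Hypothesis hA : forall c, A c -> is_chart c.
Hypothesis hcover : forall p, exists2 c, A c & dom c p.
Variables (g : M -> ((M -> R) -> R) -> ((M -> R) -> R) -> R).
Variable nabla : M -> ((M -> R) -> R) -> (M -> (M -> R) -> R) -> ((M -> R) -> R).
Variables (theta : M -> ((M -> R) -> R) -> ((M -> R) -> R)).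
Variables (xi : M -> (M -> R) -> R) (eta : M -> ((M -> R) -> R) -> R).
Hypothesis hg : riemannian_metric A g.
Hypothesis hnabla : levi_civita A g nabla.
Hypothesis hacm : almost_contact_metric A g theta xi eta.
Implicit Types (p : M) (h : M -> R) (X Y Z : M -> (M -> R) -> R) (U W : set M).
Let hn := lc_connection hnabla.

Lemma nabla_xi_ortho U p v : open U -> U p -> tangent A p v ->
  g p (nabla p v xi) (xi p) = 0.
Proof.
move=> oU Up tv; have vxi := vfield_xi hacm U.
have txi := vfield_tangent vxi Up.
have tn : tangent A p (nabla p v xi) by exact: (conn_tangent hn oU Up tv vxi).
have := lc_metric hnabla oU Up tv vxi vxi.
have -> : v (fun q => g q (xi q) (xi q)) = 0.
  rewrite (_ : (fun q => _) = fun=> 1); first exact: tangent_cst tv.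
  by apply/funext => q; rewrite (metric_xi_xi hg hacm).
rewrite (Defs.metric_sym hg txi tn) => /esym/eqP.
by rewrite -mulr2n mulrn_eq0 /= => /eqP.
Qed.

(** Metricity applied to eta = g(., xi). With vanishing torsion it amounts to d eta(X, Y) =
    g(nabla_X xi, Y) - g(nabla_Y xi, X). *)
Lemma eta_field_derive U X Y p : open U -> U p -> vfield A U X -> vfield A U Y ->
  X p (fun q => eta q (Y q)) =
  g p (cov nabla X Y p) (xi p) + g p (cov nabla X xi p) (Y p).
Proof.
move=> oU Up vX vY; have vxi := vfield_xi hacm U.
have tX := vfield_tangent vX Up.
have tn : tangent A p (nabla p (X p) xi) by exact: (conn_tangent hn oU Up tX vxi).
transitivity (X p (fun q => g q (Y q) (xi q))).
  apply: (tangent_loc hA hcover oU Up tX) => q Uq.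
  exact: (eta_metric hg hacm (vfield_tangent vY Uq)).
rewrite (lc_metric hnabla oU Up tX vY vxi) /cov; congr (_ + _).
by rewrite (Defs.metric_sym hg (vfield_tangent vY Up) tn).
Qed.

(** Derivative along X of g(theta Y, Z) = - g(theta Z, Y): nabla_X theta inherits the skewness of
    theta. *)
Lemma theta_derive_skew U X Y Z p : open U -> U p -> vfield A U X -> vfield A U Y ->
  vfield A U Z ->
  g p (cov nabla X (app theta Y) p - theta p (cov nabla X Y p)) (Z p) =
  - g p (cov nabla X (app theta Z) p - theta p (cov nabla X Z p)) (Y p).
Proof.
move=> oU Up vX vY vZ; have tX := vfield_tangent vX Up.
have vTY := vfield_theta hacm oU vY; have vTZ := vfield_theta hacm oU vZ.
have tY := vfield_tangent vY Up; have tZ := vfield_tangent vZ Up.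
have tTY := vfield_tangent vTY Up; have tTZ := vfield_tangent vTZ Up.
have tc V : vfield A U V -> tangent A p (cov nabla X V p).
  by move=> vV; exact: (conn_tangent hn oU Up tX vV).
have tt v : tangent A p v -> tangent A p (theta p v).
  exact: (endo_tangent (acm_theta hacm)).
have E1 := lc_metric hnabla oU Up tX vTY vZ.
have E2 := lc_metric hnabla oU Up tX vTZ vY.
have E : X p (fun q => g q (app theta Y q) (Z q)) = - X p (fun q => g q (app
  theta Z q) (Y q)).
  have s : smooth_near A p (fun q => g q (app theta Z q) (Y q)).
    by exists U; split=> //; apply: (metric_smooth hg).
  rewrite -(tangentN_fun hA hcover tX s).
  apply: (tangent_loc hA hcover oU Up tX) => q Uq.
  have tYq := vfield_tangent vY Uq; have tZq := vfield_tangent vZ Uq.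
  rewrite /app (theta_skew hg hacm tYq tZq) (Defs.metric_sym hg tYq) //.
  exact: (endo_tangent (acm_theta hacm)).
rewrite -/(cov nabla X (app theta Y) p) -/(cov nabla X Z p) in E1.
rewrite -/(cov nabla X (app theta Z) p) -/(cov nabla X Y p) in E2.
rewrite (metricBl hg (tc _ vTY) (tt _ (tc _ vY)) tZ) (metricBl hg (tc _ vTZ) (tt
  _ (tc _ vZ)) tY).
rewrite (theta_skew hg hacm (tc _ vY) tZ) (theta_skew hg hacm (tc _ vZ) tY).
rewrite E2 E1 /app in E.
rewrite (Defs.metric_sym hg (tc _ vY) tTZ) (Defs.metric_sym hg (tc _ vZ) tTY).
rewrite /app in E *; lra.
Qed.

Hypothesis hnormal : normal A theta xi eta.

Lemma cov_xi_theta U X p : open U -> U p -> vfield A U X ->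
  cov nabla (app theta X) xi p = theta p (cov nabla X xi p).
Proof.
move=> oU Up vX; have vxi := vfield_xi hacm U.
have vT Y : vfield A U Y -> vfield A U (app theta Y) by exact: (vfield_theta hacm
  oU).
have vc Y Z : vfield A U Y -> vfield A U Z -> vfield A U (cov nabla Y Z).
  exact: (vfield_cov hnabla oU).
have tt v : tangent A p v -> tangent A p (theta p v).
  exact: (endo_tangent (acm_theta hacm)).
pose V Y q := cov nabla (app theta Y) xi q - theta q (cov nabla Y xi q).
have vV Y : vfield A U Y -> vfield A U (V Y).
  move=> vY; apply: (vfieldB hA oU); first by apply: vc => //; exact: vT.
  by apply: vT; exact: vc.
have tf Y : vfield A U Y -> tangent A p (Y p) by move=> vY;
  exact: vfield_tangent vY p Up.
(* As L_xi theta = 0, the defect V of commutation is nabla_xi theta. *)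
have VE Y : vfield A U Y -> V Y p = cov nabla xi (app theta Y) p - theta p (cov
  nabla xi Y p).
  move=> vY; have := Lie_xi_theta hA hcover hnabla hacm hnormal oU vY Up.
  rewrite (bracketE hnabla oU vxi (vT _ vY) Up) (bracketE hnabla oU vxi vY Up).
  rewrite (thetaB hacm (tf _ (vc _ _ vxi vY)) (tf _ (vc _ _ vY vxi))) /V.
  move/eqP; rewrite subr_eq => /eqP ->.
  by rewrite addrAC [_ - _ - _]addrAC subrr add0r addrC.
have skew Y Z : vfield A U Y -> vfield A U Z -> g p (V Y p) (Z p) = - g p (V Z p)
  (Y p).
  by move=> vY vZ; rewrite !VE //; exact: theta_derive_skew oU Up vxi vY vZ.
have Vg Y Z : vfield A U Y -> vfield A U Z -> g p (V Y p) (Z p) =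
    g p (cov nabla (app theta Y) xi p) (Z p) + g p (cov nabla Y xi p) (theta p (Z
      p)).
  move=> vY vZ; rewrite (metricBl hg (tf _ (vc _ _ (vT _ vY) vxi)) (tt _ (tf _
    (vc _ _ vY vxi))) (tf _ vZ)).
  by rewrite (theta_skew hg hacm (tf _ (vc _ _ vY vxi)) (tf _ vZ)) opprK.
(* By [Vg], g(V Y, Z) - g(V Z, Y) is d eta(theta Y, Z) + d eta(Y, theta Z) written with nabla xi. *)
have symm Y Z : vfield A U Y -> vfield A U Z -> g p (V Y p) (Z p) = g p (V Z p)
  (Y p).
  move=> vY vZ; have vTY := vT _ vY; have vTZ := vT _ vZ.
  have := deta_theta hA hcover hnabla hacm hnormal oU vY vZ Up.
  rewrite -/(app theta Y p) -/(app theta Z p).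
  rewrite (eta_field_derive oU Up vTY vZ) (eta_field_derive oU Up vTZ vY).
  rewrite (bracketE hnabla oU vTY vZ Up) (bracketE hnabla oU vY vTZ Up).
  have t1 := tf _ (vc _ _ vTY vZ); have t2 := tf _ (vc _ _ vZ vTY).
  have t3 := tf _ (vc _ _ vY vTZ); have t4 := tf _ (vc _ _ vTZ vY).
  rewrite (eta_metric hg hacm (tangentD (tangentB t1 t2) (tangentB t3 t4))).
  rewrite (metricDl hg (tangentB t1 t2) (tangentB t3 t4) (tf _ vxi)).
  rewrite (metricBl hg t1 t2 (tf _ vxi)) (metricBl hg t3 t4 (tf _ vxi)) !Vg //.
  (* Differentiating eta(theta Y) = 0 trades g(nabla_Z (theta Y), xi) for - g(nabla_Z xi, theta Y);
     [z2] does the same with Y and Z exchanged. *)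
  have z1 : Z p (fun q => eta q (app theta Y q)) = 0.
    rewrite (tangent_loc hA hcover oU Up (tf _ vZ) (h := fun=> 0)).
      exact: (tangent_cst hA hcover _ (tf _ vZ)).
    by move=> q Uq; apply: (eta_theta hacm (vfield_tangent vY Uq)).
  have z2 : Y p (fun q => eta q (app theta Z q)) = 0.
    rewrite (tangent_loc hA hcover oU Up (tf _ vY) (h := fun=> 0)).
      exact: (tangent_cst hA hcover _ (tf _ vY)).
    by move=> q Uq; apply: (eta_theta hacm (vfield_tangent vZ Uq)).
  rewrite (eta_field_derive oU Up vZ vTY) in z1.
  rewrite (eta_field_derive oU Up vY vTZ) in z2.
  rewrite /app in z1 z2 *; lra.
apply/eqP; rewrite -subr_eq0; apply/eqP; rewrite -/(V X p).
apply: (metric_eq0 hg (tf _ (vV _ vX))).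
(* Tested against the field V X itself: g(V X, V X) equals both g(V (V X), X) and its opposite. *)
have s1 := skew _ _ vX (vV _ vX); have s2 := symm _ _ vX (vV _ vX).
by lra.
Qed.

End CovariantDerivativeOfReebField.

(** * Traces *)

Section Traces.
Variables (R : realType) (M : topologicalType) (n : nat).
Let d := n.*2.+1.
Variable A : set (chart R M d).
Hypothesis hA : forall c, A c -> is_chart c.
Hypothesis hcover : forall p, exists2 c, A c & dom c p.
Variables (g : M -> ((M -> R) -> R) -> ((M -> R) -> R) -> R).
Variable nabla : M -> ((M -> R) -> R) -> (M -> (M -> R) -> R) -> ((M -> R) -> R).
Variables (theta : M -> ((M -> R) -> R) -> ((M -> R) -> R)).
Variables (xi : M -> (M -> R) -> R) (eta : M -> ((M -> R) -> R) -> R).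
Hypothesis hg : riemannian_metric A g.
Hypothesis hnabla : levi_civita A g nabla.
Hypothesis hacm : almost_contact_metric A g theta xi eta.
Implicit Types (p : M) (h : M -> R) (X Y Z : M -> (M -> R) -> R).

(** The second covariant derivative of xi. Unlike nabla_X nabla_Y xi it is tensorial in both
    arguments, which is what allows traces over the frames E and F to be compared. *)
Definition second_cov X Y p : (M -> R) -> R :=
  cov nabla X (cov nabla Y xi) p - cov nabla (cov nabla X Y) xi p.

Variable U : set M.
Hypothesis oU : open U.
Let hn := lc_connection hnabla.
Let vxi := vfield_xi hacm U.
Let vc Y Z : vfield A U Y -> vfield A U Z -> vfield A U (cov nabla Y Z).
Proof. exact: (vfield_cov hnabla oU). Qed.
Let vT Y : vfield A U Y -> vfield A U (app theta Y).
Proof. exact: (vfield_theta hacm oU). Qed.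
Let tt q v : tangent A q v -> tangent A q (theta q v).
Proof. exact: (endo_tangent (acm_theta hacm)). Qed.

Lemma tangent_second_cov X Y p : vfield A U X -> vfield A U Y -> U p ->
  tangent A p (second_cov X Y p).
Proof.
move=> vX vY Up; apply: tangentB.
  exact: (vfield_tangent (vc vX (vc vY vxi)) Up).
exact: (vfield_tangent (vc (vc vX vY) vxi) Up).
Qed.

(** Vanishing torsion splits the bracket term into the correction terms of the two second
    derivatives. *)
Lemma curvature_second_cov X Y p : vfield A U X -> vfield A U Y -> U p ->
  curvature A nabla X Y xi p = second_cov X Y p - second_cov Y X p.
Proof.
move=> vX vY Up; rewrite /curvature /second_cov.
have -> : cov nabla (bracket A X Y) xi p =
    cov nabla (cov nabla X Y) xi p - cov nabla (cov nabla Y X) xi p.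
  rewrite {1}/cov (bracketE hnabla oU vX vY Up).
  rewrite (nabla_vecB hn oU Up (vfield_tangent (vc vX vY) Up)) //.
  exact: (vfield_tangent (vc vY vX) Up).
by rewrite !opprB addrACA [RHS]addrACA [- _ + _]addrC.
Qed.

Variable E : 'I_d -> M -> (M -> R) -> R.
Hypothesis hE : orthonormal_frame A g (tangent A) U E.
Let vE := frame_vfield hE.
Let tE i q : U q -> tangent A q (E i q).
Proof. exact: (vfield_tangent (vE i)). Qed.

Lemma second_cov_framel X Y p : vfield A U X -> vfield A U Y -> U p ->
  second_cov X Y p = \sum_i g p (X p) (E i p) *: second_cov (E i) Y p.
Proof.
move=> vX vY Up; have tX := vfield_tangent vX Up.
have XE := frame_expand hg (fun _ _ t => t) hE Up tX.
have H Z : vfield A U Z ->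
    nabla p (X p) Z = \sum_i g p (X p) (E i p) *: nabla p (E i p) Z.
  move=> vZ; rewrite {1}XE (nabla_vec_sum hn _ oU Up _ vZ).
    by apply: eq_bigr => i _; rewrite (nabla_vecZ hn _ oU Up (tE i Up) vZ).
  by move=> i; apply: tangentZ; exact: tE.
rewrite /second_cov /cov (H _ (vc vY vxi)) (H _ vY).
have tn i : tangent A p (nabla p (E i p) Y) by exact: (vfield_tangent (vc (vE i)
  vY) Up).
rewrite (nabla_vec_sum hn _ oU Up _ vxi); last by move=> i; exact: tangentZ.
rewrite -sumrB; apply: eq_bigr => i _.
by rewrite (nabla_vecZ hn _ oU Up (tn i) vxi) scalerBr.
Qed.

(** Tensoriality in Y: the derivatives X(y_j) of the coefficients of Y occur in both terms of
    [second_cov] and cancel. *)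
Lemma second_cov_framer X Y p : vfield A U X -> vfield A U Y -> U p ->
  second_cov X Y p = \sum_j g p (Y p) (E j p) *: second_cov X (E j) p.
Proof.
move=> vX vY Up; have tX := vfield_tangent vX Up.
pose y j q := g q (Y q) (E j q).
have sy j : smooth A U (y j) by exact: (metric_smooth hg oU vY (vE j)).
have YE q : U q -> Y q = \sum_j y j q *: E j q.
  by move=> Uq; exact: (frame_expand hg (fun _ _ t => t) hE Uq (vfield_tangent vY
    Uq)).
have H1 : nabla p (X p) Y = \sum_j (y j p *: nabla p (X p) (E j) + X p (y j) *: E
  j p).
  by rewrite (conn_local hn oU Up tX YE) (nabla_sumZ hA hcover hn _ oU Up tX sy vE).
have H2 : nabla p (X p) (cov nabla Y xi) = \sum_j (y j p *: nabla p (X p) (cov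
  nabla (E j) xi)
    + X p (y j) *: cov nabla (E j) xi p).
  have YE' q : U q -> cov nabla Y xi q = \sum_j y j q *: cov nabla (E j) xi q.
    move=> Uq; rewrite {1}/cov (YE q Uq) (nabla_vec_sum hn _ oU Uq _ vxi).
      by apply: eq_bigr => j _; rewrite (nabla_vecZ hn _ oU Uq (tE j Uq) vxi).
    by move=> j; apply: tangentZ; exact: tE.
  rewrite (conn_local hn oU Up tX YE') (nabla_sumZ hA hcover hn _ oU Up tX sy) //.
  by move=> j; exact: vc.
have tn j : tangent A p (nabla p (X p) (E j)) by exact: (vfield_tangent (vc vX
  (vE j)) Up).
rewrite /second_cov /cov H1 -/(cov nabla Y xi) H2.
rewrite (nabla_vec_sum hn _ oU Up _ vxi); last first.
  by move=> j; apply: tangentD; apply: tangentZ => //; exact: tE.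
rewrite -sumrB; apply: eq_bigr => j _.
rewrite (nabla_vecD hn oU Up (tangentZ _ (tn j)) (tangentZ _ (tE j Up)) vxi).
rewrite (nabla_vecZ hn _ oU Up (tn j) vxi) (nabla_vecZ hn _ oU Up (tE j Up) vxi).
by rewrite opprD addrACA /cov subrr addr0 scalerBr.
Qed.

(** Derivative of g(nabla_{E_i} xi, xi) = 0 along E_i; the correction terms are orthogonal to xi for
    the same reason. *)
Lemma metric_trace_second_cov p : U p ->
  g p (\sum_i second_cov (E i) (E i) p) (xi p) = - norm2_nabla g nabla E xi p.
Proof.
move=> Up; have txi := vfield_tangent vxi Up.
rewrite (metric_suml hg) //; last by move=> i; exact: tangent_second_cov.
rewrite /norm2_nabla -sumrN; apply: eq_bigr => i _.
have vEx := vc (vE i) vxi; have tEx := vfield_tangent vEx Up.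
have := lc_metric hnabla oU Up (tE i Up) vEx vxi.
rewrite (tangent_loc hA hcover oU Up (tE i Up) (h := fun=> 0)); last first.
  by move=> q Uq; exact: (nabla_xi_ortho hA hcover hg hnabla hacm oU Uq (tE i Uq)).
rewrite (tangent_cst hA hcover 0 (tE i Up)) => /esym/eqP;
  rewrite addr_eq0 => /eqP <-.
have t1 := vfield_tangent (vc (vE i) vEx) Up.
have t2 := vfield_tangent (vc (vc (vE i) (vE i)) vxi) Up.
rewrite (metricBl hg t1 t2 txi) [X in _ - X](nabla_xi_ortho hA hcover hg hnabla
  hacm oU Up).
  by rewrite subr0.
exact: (vfield_tangent (vc (vE i) (vE i)) Up).
Qed.

Variable F : 'I_n.*2 -> M -> (M -> R) -> R.
Hypothesis hF : orthonormal_frame A g (horizontal A g xi) U F.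
Let vF := frame_vfield hF.
Let tF k q : U q -> tangent A q (F k q).
Proof. exact: (vfield_tangent (vF k)). Qed.

(** Both sides contract the second covariant derivative of xi with the matrix of theta.
    Antisymmetrising, as the curvature does, against this skew matrix produces the factor 2. *)
Lemma sum_curvature_theta p : U p ->
  \sum_k curvature A nabla (F k) (app theta (F k)) xi p =
  2 *: \sum_i second_cov (E i) (app theta (E i)) p.
Proof.
move=> Up; pose B i j := second_cov (E i) (E j) p.
have H X Y : vfield A U X -> vfield A U Y -> second_cov X Y p =
    \sum_i \sum_j (g p (X p) (E i p) * g p (Y p) (E j p)) *: B i j.
  move=> vX vY; rewrite (second_cov_framel vX vY Up); apply: eq_bigr => i _.
  rewrite (second_cov_framer (vE i) vY Up) scaler_sumr.
  by apply: eq_bigr => j _; rewrite scalerA.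
have HE i : second_cov (E i) (app theta (E i)) p =
    \sum_j g p (theta p (E i p)) (E j p) *: B i j.
  by rewrite (second_cov_framer (vE i) (vT (vE i)) Up).
(* The sum over the horizontal frame loses nothing, because theta E_j is horizontal and so equals
   its expansion in F. *)
have trF i j : \sum_k g p (F k p) (E i p) * g p (theta p (F k p)) (E j p) =
    g p (theta p (E i p)) (E j p).
  have tj := tt (tE j Up).
  have hj : horizontal A g xi p (theta p (E j p)).
    by split=> //; rewrite -(eta_metric hg hacm tj) (eta_theta hacm (tE j Up)).
  have hT q w : horizontal A g xi q w -> tangent A q w by case.
  have := frame_expand hg hT hF Up hj.
  move/(congr1 (fun v => g p v (E i p))).
  have tk k : tangent A p (g p (theta p (E j p)) (F k p) *: F k p).
    by apply: tangentZ; exact: tF.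
  rewrite (metric_suml hg _ tk (tE i Up)).
  rewrite (theta_skew hg hacm (tE i Up) (tE j Up)) (Defs.metric_sym hg (tE i Up)
    tj) => ->.
  rewrite -sumrN; apply: eq_bigr => k _; rewrite (metricZl hg _ (tF k Up) (tE i
    Up)).
  rewrite (theta_skew hg hacm (tF k Up) (tE j Up)) (Defs.metric_sym hg (tF k Up)
    tj).
  by rewrite mulrN mulrC.
have tskew i j : g p (theta p (E i p)) (E j p) = - g p (theta p (E j p)) (E i p).
  rewrite (theta_skew hg hacm (tE i Up) (tE j Up)).
  by rewrite (Defs.metric_sym hg (tE i Up) (tt (tE j Up))).
transitivity (\sum_i \sum_j (2 * g p (theta p (E i p)) (E j p)) *: B i j).
  transitivity (\sum_k \sum_i \sum_j
    (g p (F k p) (E i p) * g p (theta p (F k p)) (E j p)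
     - g p (F k p) (E j p) * g p (theta p (F k p)) (E i p)) *: B i j).
    apply: eq_bigr => k _.
    rewrite (curvature_second_cov (vF k) (vT (vF k)) Up) !H ?vT //; try exact: vT.
    rewrite -sumrB; apply: eq_bigr => i _; rewrite -sumrB; apply: eq_bigr => j _.
    by rewrite scalerBl /app [g p (F k p) (E j p) * _]mulrC.
  rewrite exchange_big /=; apply: eq_bigr => i _.
  rewrite exchange_big /=; apply: eq_bigr => j _.
  rewrite -scaler_suml sumrB trF trF (tskew j i) opprK; congr (_ *: _).
  by rewrite mulr2n mulrDl mul1r.
rewrite scaler_sumr; apply: eq_bigr => i _; rewrite HE scaler_sumr.
by apply: eq_bigr => j _; rewrite scalerA.
Qed.

Lemma theta_hproj p v : tangent A p v -> theta p (hproj g xi p v) = theta p v.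
Proof.
move=> tv; have txi : tangent A p (xi p) by exact: (vfield_tangent (acm_xi hacm)).
rewrite /hproj (thetaB hacm tv (tangentZ _ txi)) (thetaZ hacm _ txi).
by rewrite (theta_xi hacm) scaler0 subr0.
Qed.

(** The T of the overview, that is [trace_bar_J] without the horizontal projections. *)
Definition trace_nabla_theta p : (M -> R) -> R :=
  \sum_i (cov nabla (E i) (app theta (cov nabla (E i) xi)) p
          - theta p (cov nabla (E i) (cov nabla (E i) xi) p)).

Lemma tangent_trace_nabla_theta p : U p -> tangent A p (trace_nabla_theta p).
Proof.
move=> Up; apply: tangent_sum => i _; have v1 := vc (vE i) vxi.
apply: tangentB; first exact: (vfield_tangent (vc (vE i) (vT v1)) Up).
exact: (tt (vfield_tangent (vc (vE i) v1) Up)).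
Qed.

(** The projections only change vectors by multiples of xi, which theta kills. *)
Lemma theta_trace_bar_J p : U p ->
  theta p (trace_bar_J g nabla theta xi E p) = theta p (trace_nabla_theta p).
Proof.
move=> Up; have txi := vfield_tangent vxi Up.
have thp v : tangent A p v -> tangent A p (hproj g xi p v).
  by move=> tv; apply: tangentB => //; exact: tangentZ.
rewrite /trace_bar_J /trace_nabla_theta !(theta_sum hacm).
- apply: eq_bigr => i _; have v1 := vc (vE i) vxi.
  have t1 := vfield_tangent (vc (vE i) (vT v1)) Up.
  have t2 := vfield_tangent (vc (vE i) v1) Up.
  rewrite /bar_nabla_J /bar_nabla (thetaB hacm (thp _ t1) (tt (thp _ t2))).
  by rewrite (theta_hproj t1) (theta_hproj t2) (thetaB hacm t1 (tt t2)).
- move=> i; have v1 := vc (vE i) vxi.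
  apply: tangentB; first exact: (vfield_tangent (vc (vE i) (vT v1)) Up).
  exact: (tt (vfield_tangent (vc (vE i) v1) Up)).
- move=> i; have v1 := vc (vE i) vxi.
  have t1 := vfield_tangent (vc (vE i) (vT v1)) Up.
  have t2 := vfield_tangent (vc (vE i) v1) Up.
  by apply: tangentB; [exact: thp|exact/tt/thp].
Qed.

Hypothesis hnormal : normal A theta xi eta.
Let comm X p : U p -> vfield A U X ->
  cov nabla (app theta X) xi p = theta p (cov nabla X xi p).
Proof. exact: (cov_xi_theta hA hcover hg hnabla hacm hnormal oU). Qed.

Lemma tangent_delta_theta p : U p -> tangent A p (delta_theta nabla theta E p).
Proof.
move=> Up; apply: tangent_sum => i _; apply: tangentB.
  exact: (vfield_tangent (vc (vE i) (vT (vE i))) Up).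
exact: (tt (vfield_tangent (vc (vE i) (vE i)) Up)).
Qed.

(** The commutation rule turns nabla_{theta E_i} xi into theta (nabla_{E_i} xi) before the
    derivative along E_i. In the correction term, nabla_{E_i} (theta E_i) = (nabla_{E_i} theta) E_i
    + theta (nabla_{E_i} E_i): the first part sums to delta theta, and the commutation rule applies
    again to the second. *)
Lemma sum_second_cov_theta p : U p ->
  \sum_i second_cov (E i) (app theta (E i)) p =
  trace_nabla_theta p + theta p (\sum_i second_cov (E i) (E i) p)
  - nabla p (delta_theta nabla theta E p) xi.
Proof.
move=> Up; have tc Y Z : vfield A U Y -> vfield A U Z -> tangent A p (cov nabla Y
  Z p).
  by move=> vY vZ; exact: (vfield_tangent (vc vY vZ) Up).
rewrite (theta_sum hacm); last by move=> i; exact: tangent_second_cov.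
rewrite /delta_theta (nabla_vec_sum hn _ oU Up _ vxi); last first.
  by move=> i; apply: tangentB; [exact: (tc _ _ (vE i) (vT (vE i)))|exact: tt (tc
    _ _ (vE i) (vE i))].
rewrite /trace_nabla_theta -big_split -sumrB /=; apply: eq_bigr => i _.
have vi := vE i; have v1 := vc vi vxi.
rewrite /nabla_theta (nabla_vecB hn oU Up (tc _ _ vi (vT vi)) (tt (tc _ _ vi vi))
  vxi).
rewrite -[nabla p (theta p _) xi]/(cov nabla (app theta (cov nabla (E i) (E i)))
  xi p).
rewrite (comm Up (vc vi vi)) /second_cov.
rewrite (thetaB hacm (tc _ _ vi v1) (tc _ _ (vc vi vi) vxi)).
(* The commuting fields are differentiated here, so their equality on all of U is used, through
   locality. *)
have -> : cov nabla (E i) (cov nabla (app theta (E i)) xi) p =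
    cov nabla (E i) (app theta (cov nabla (E i) xi)) p.
  by apply: (conn_local hn oU Up (tE i Up)) => q Uq; exact: comm Uq vi.
by rewrite addrA subrK opprB addrA subrK.
Qed.

(** As theta xi = 0, the commutator [R, theta] xi is - theta (R xi) and (nabla_{delta theta} theta)
    xi is - theta (nabla_{delta theta} xi). The remaining theta^2 of the trace of [second_cov] is
    minus its horizontal part, whence the Laplacian on the right. *)
Lemma second_equation_rhs p : U p ->
  2^-1 *: (\sum_k curvature_theta A nabla theta (F k) (app theta (F k)) xi p)
    + nabla_theta nabla theta (delta_theta nabla theta E) xi p =
  - theta p (trace_bar_J g nabla theta xi E p)
  - (rough_laplacian nabla E xi p - norm2_nabla g nabla E xi p *: xi p).
Proof.
move=> Up; have txi := vfield_tangent vxi Up.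
have Txi : app theta xi = fun=> 0 by apply/funext => q; exact: (theta_xi hacm).
have cov0 X q : U q -> vfield A U X -> cov nabla X (fun=> 0) q = 0.
  by move=> Uq vX; exact: (nabla0 hA hcover hn (vfield_tangent vX Uq)).
have R0 X Y : vfield A U X -> vfield A U Y -> curvature A nabla X Y (fun=> 0) p = 0.
  move=> vX vY; rewrite /curvature.
  rewrite [cov nabla X _ p](nabla_eq0 hA hcover hn oU Up (vfield_tangent vX Up));
    last first.
    by move=> q Uq; exact: cov0.
  rewrite [cov nabla Y _ p](nabla_eq0 hA hcover hn oU Up (vfield_tangent vY Up));
    last first.
    by move=> q Uq; exact: cov0.
  rewrite [cov nabla _ _ p](nabla0 hA hcover hn) ?subr0 //.
  exact: (tangent_bracket hnabla oU vX vY Up).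
have td := tangent_delta_theta Up.
have t1 : tangent A p (\sum_i second_cov (E i) (E i) p).
  by apply: tangent_sum => i _; exact: tangent_second_cov.
have tS : tangent A p (\sum_i second_cov (E i) (app theta (E i)) p).
  by apply: tangent_sum => i _; apply: tangent_second_cov => //; exact: vT.
have tdx : tangent A p (nabla p (delta_theta nabla theta E p) xi).
  exact: (conn_tangent hn oU Up td vxi).
have -> : \sum_k curvature_theta A nabla theta (F k) (app theta (F k)) xi p =
    - theta p (2 *: \sum_i second_cov (E i) (app theta (E i)) p).
  rewrite -(sum_curvature_theta Up) (theta_sum hacm).
    rewrite -sumrN; apply: eq_bigr => k _.
    by rewrite /curvature_theta Txi (R0 _ _ (vF k) (vT (vF k))) sub0r.
  move=> k; rewrite (curvature_second_cov (vF k) (vT (vF k)) Up).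
  by apply: tangentB; apply: tangent_second_cov => //; exact: vT.
have -> : nabla_theta nabla theta (delta_theta nabla theta E) xi p =
    - theta p (nabla p (delta_theta nabla theta E p) xi).
  by rewrite /nabla_theta Txi {1}/cov (nabla0 hA hcover hn td) sub0r.
rewrite (thetaZ hacm _ tS) scalerN scalerA mulVf ?scale1r;
  last by rewrite pnatr_eq0.
(* The factor 1/2 has absorbed the 2 of the curvature sum; the two terms nabla_{delta theta} xi now
   cancel under theta. *)
rewrite -opprD -(thetaD hacm tS tdx) (sum_second_cov_theta Up) subrK.
rewrite (thetaD hacm (tangent_trace_nabla_theta Up) (tt t1)) (acm_theta2 hacm t1).
rewrite (theta_trace_bar_J Up) (eta_metric hg hacm t1) (metric_trace_second_cov Up).
rewrite opprD; congr (_ + _).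
by rewrite /rough_laplacian /second_cov scaleNr.
Qed.

End Traces.

(** * Horizontal frames *)

Section HorizontalFrame.
Variables (R : realType) (M : topologicalType) (m : nat) (A : set (chart R M m.+1)).
Hypothesis hA : forall c, A c -> is_chart c.
Hypothesis hcover : forall p, exists2 c, A c & dom c p.
Variables (g : M -> ((M -> R) -> R) -> ((M -> R) -> R) -> R).
Hypothesis hg : riemannian_metric A g.
Implicit Types (p q : M) (U : set M).

Lemma orthonormal_frame_sub k (B : M -> ((M -> R) -> R) -> Prop) U V
    (E : 'I_k -> M -> (M -> R) -> R) :
  V `<=` U -> orthonormal_frame A g B U E -> orthonormal_frame A g B V E.
Proof.
move=> VU [v1 v2 v3 v4]; split=> [i|i p /VU|i j p /VU|p v /VU]; last exact: v4.
- exact: vfield_sub VU (v1 i).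
- exact: v2.
- exact: v3.
Qed.

Variables (U : set M) (E : 'I_m.+1 -> M -> (M -> R) -> R) (zeta : M -> (M -> R)
  -> R).
Hypothesis oU : open U.
Hypothesis hE : orthonormal_frame A g (tangent A) U E.
Hypothesis vz : vfield A U zeta.
Hypothesis zeta1 : forall q, U q -> g q (zeta q) (zeta q) = 1.
Hypothesis b0 : forall q, U q -> 1 + g q (zeta q) (E ord0 q) != 0.

Let b i q := g q (zeta q) (E i q).

(* The reflection exchanging [E ord0] and [- zeta], applied to the other [E i]. *)
Definition reflected_frame (j : 'I_m) q : (M -> R) -> R :=
  E (lift ord0 j) q
  - (g q (zeta q) (E (lift ord0 j) q) / (1 + g q (zeta q) (E ord0 q)))
      *: (E ord0 q + zeta q).

Let tE i q : U q -> tangent A q (E i q).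
Proof. exact: (vfield_tangent (frame_vfield hE i)). Qed.

Let tz q : U q -> tangent A q (zeta q).
Proof. exact: (vfield_tangent vz). Qed.

Let gE i j q : U q -> g q (E i q) (E j q) = (i == j)%:R.
Proof. exact: (frame_orthonormal hE). Qed.

Lemma reflected_frame_vfield j : vfield A U (reflected_frame j).
Proof.
have vE i := frame_vfield hE i.
have sb i : smooth A U (b i) by exact: (metric_smooth hg oU vz (vE i)).
apply: (vfieldB hA oU (vE _)); apply: (vfieldZ hA oU); last exact: (vfieldD hA oU).
apply: (smoothM hA oU (sb _)); apply: (smoothV hA oU) => //.
by apply: (smoothD hA oU _ (sb _)); exact: smooth_cst.
Qed.

Lemma metric_frame q v w : U q -> tangent A q v -> tangent A q w ->
  g q v w = \sum_i g q v (E i q) * g q w (E i q).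
Proof.
move=> Uq tv tw; rewrite {1}(frame_expand hg (fun _ _ t => t) hE Uq tv).
have t i : tangent A q (g q v (E i q) *: E i q) by apply: tangentZ; exact: tE.
rewrite (metric_suml hg _ t tw); apply: eq_bigr => i _.
by rewrite (metricZl hg _ (tE i Uq) tw) (Defs.metric_sym hg (tE i Uq) tw).
Qed.

Lemma reflected_frame_metric j q w : U q -> tangent A q w ->
  g q w (reflected_frame j q) = g q w (E (lift ord0 j) q)
   - b (lift ord0 j) q / (1 + b ord0 q) * (g q w (E ord0 q) + g q w (zeta q)).
Proof.
move=> Uq tw; rewrite /reflected_frame.
have ts := tangentD (tE ord0 Uq) (tz Uq).
rewrite (metricBr hg (tE _ Uq) (tangentZ _ ts) tw) (metricZr hg _ ts tw).
by rewrite (metricDr hg (tE _ Uq) (tz Uq) tw).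
Qed.

(** The reason behind the computation: an isometry taking E_0 to - zeta takes the other E_j, which
    are orthogonal to E_0, to vectors orthogonal to zeta. The division is cancelled thanks to
    [b0]. *)
Lemma reflected_frame_zeta j q : U q -> g q (zeta q) (reflected_frame j q) = 0.
Proof.
move=> Uq; rewrite (reflected_frame_metric j Uq (tz Uq)) zeta1 //.
rewrite -/(b ord0 q) -/(b (lift ord0 j) q).
by rewrite [b ord0 q + 1]addrC divfK ?b0 // subrr.
Qed.

Lemma reflected_frame_E0 j q : U q ->
  g q (E ord0 q) (reflected_frame j q) = - b (lift ord0 j) q.
Proof.
move=> Uq; rewrite (reflected_frame_metric j Uq (tE _ Uq)) !gE // eqxx.
rewrite (Defs.metric_sym hg (tE _ Uq) (tz Uq)) -/(b ord0 q).
by rewrite divfK ?b0 // sub0r.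
Qed.

Lemma reflected_frame_orthonormal i j q : U q ->
  g q (reflected_frame i q) (reflected_frame j q) = (i == j)%:R.
Proof.
move=> Uq; have tF := vfield_tangent (reflected_frame_vfield j) Uq.
have ts := tangentD (tE ord0 Uq) (tz Uq).
rewrite {1}/reflected_frame (metricBl hg (tE _ Uq) (tangentZ _ ts) tF).
rewrite (metricZl hg _ ts tF) (metricDl hg (tE _ Uq) (tz Uq) tF).
rewrite reflected_frame_E0 // reflected_frame_zeta // addr0.
rewrite (reflected_frame_metric j Uq (tE _ Uq)) !gE //.
rewrite (Defs.metric_sym hg (tE _ Uq) (tz Uq)) -!/(b _ q).
rewrite (inj_eq lift_inj) eq_sym (eq_sym _ ord0) (negbTE (neq_lift _ _)) add0r.
by ring.
Qed.

(** Instead of counting dimensions, the residual of v is shown to be zero: it is orthogonal to zeta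
    and to the reflected frame, which determines its components in E. *)
Lemma reflected_frame_span q v : U q -> tangent A q v -> g q v (zeta q) = 0 ->
  v = \sum_j g q v (reflected_frame j q) *: reflected_frame j q.
Proof.
move=> Uq tv vz0.
pose w := v - \sum_j g q v (reflected_frame j q) *: reflected_frame j q.
have tF j := vfield_tangent (reflected_frame_vfield j) Uq.
have tS : tangent A q (\sum_j g q v (reflected_frame j q) *: reflected_frame j q).
  by apply: tangent_sum => j _; exact: tangentZ.
have tw : tangent A q w by exact: tangentB.
have wF j : g q w (reflected_frame j q) = 0.
  rewrite (metricBl hg tv tS (tF j)).
  have tk k : tangent A q (g q v (reflected_frame k q) *: reflected_frame k q).
    exact: tangentZ.
  rewrite (metric_suml hg _ tk (tF j)) (bigD1 j) //= (metricZl hg _ (tF j) (tF j)).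
  rewrite reflected_frame_orthonormal // eqxx mulr1 big1 ?addr0 ?subrr // => i ij.
  by rewrite (metricZl hg _ (tF i) (tF j)) reflected_frame_orthonormal // (negbTE
    ij) mulr0.
have wz : g q w (zeta q) = 0.
  rewrite (metricBl hg tv tS (tz Uq)) vz0.
  have tk k : tangent A q (g q v (reflected_frame k q) *: reflected_frame k q).
    exact: tangentZ.
  rewrite (metric_suml hg _ tk (tz Uq)) big1 ?subr0 // => i _.
  rewrite (metricZl hg _ (tF i) (tz Uq)) (Defs.metric_sym hg (tF i) (tz Uq)).
  by rewrite reflected_frame_zeta // mulr0.
suff w0 : w = 0 by apply/eqP; rewrite -subr_eq0; apply/eqP.
pose w_ i := g q w (E i q).
have wj j : w_ (lift ord0 j) = b (lift ord0 j) q * (w_ ord0 / (1 + b ord0 q)).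
  have := wF j; rewrite (reflected_frame_metric j Uq tw) wz addr0 => /eqP.
  by rewrite subr_eq0 => /eqP; rewrite /w_ => ->; rewrite mulrAC mulrA.
(* With w_j = b_j w_0 / (1 + b_0) and |zeta| = 1, the relation g(w, zeta) = 0 becomes w_0 b_0 + w_0
   (1 - b_0^2) / (1 + b_0) = 0, whose left side is w_0. *)
have wE0 : w_ ord0 = 0.
  have := wz; rewrite (metric_frame Uq tw (tz Uq)) big_ord_recl -/(w_ ord0) -/(b
    ord0 q).
  rewrite (eq_bigr (fun j => w_ ord0 / (1 + b ord0 q) * b (lift ord0 j) q ^+ 2));
    last first.
    by move=> j _; rewrite -/(w_ _) wj -/(b _ q) expr2; ring.
  rewrite -mulr_sumr.
  have := zeta1 Uq; rewrite (metric_frame Uq (tz Uq) (tz Uq)) big_ord_recl -/(b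
    ord0 q).
  rewrite (eq_bigr (fun j => b (lift ord0 j) q ^+ 2)) // => bs.
  have -> : \sum_(i < m) b (lift ord0 i) q ^+ 2 = 1 - b ord0 q * b ord0 q.
    by rewrite -bs addrC addKr.
  have nz := b0 Uq; rewrite -/(b ord0 q) in nz.
  have -> : 1 - b ord0 q * b ord0 q = (1 + b ord0 q) * (1 - b ord0 q) by ring.
  by rewrite mulrA divfK // => H; rewrite -H; ring.
have wi i : w_ i = 0.
  by case: (unliftP ord0 i) => [j ->|-> //]; rewrite wj wE0 mul0r mulr0.
rewrite (frame_expand hg (fun _ _ t => t) hE Uq tw) big1 // => i _.
by rewrite -/(w_ i) wi scale0r.
Qed.

End HorizontalFrame.

(** The reflected frame for zeta = xi or - xi, which have the same orthogonal complement, over the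
    open set where the denominator of the reflection does not vanish. *)
Lemma exists_horizontal_frame (R : realType) (M : topologicalType) (m : nat)
    (A : set (chart R M m.+1)) (g : M -> ((M -> R) -> R) -> ((M -> R) -> R) -> R)
    (xi : M -> (M -> R) -> R) (U : set M) (E : 'I_m.+1 -> M -> (M -> R) -> R) p :
  (forall c, A c -> is_chart c) -> (forall q, exists2 c, A c & dom c q) ->
  riemannian_metric A g -> vfield A setT xi -> (forall q, g q (xi q) (xi q) = 1) ->
  open U -> U p -> orthonormal_frame A g (tangent A) U E ->
  exists V (F : 'I_m -> M -> (M -> R) -> R),
    [/\ open V, V p, V `<=` U & orthonormal_frame A g (horizontal A g xi) V F].
Proof.
move=> hA hcover hg hxi xi1 oU Up hE.
have txi q : tangent A q (xi q) by exact: (vfield_tangent hxi).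
(* The sign makes g(zeta, E_0) nonnegative at p, so the denominator 1 + g(zeta, E_0) is at least 1
   there and nonzero nearby. *)
pose s : R := if 0 <= g p (xi p) (E ord0 p) then 1 else -1.
have ss : s * s = 1 by rewrite /s; case: ifP; rewrite ?mulr1 // mulrNN mulr1.
have s0 : s != 0 by apply/eqP => s0; move: ss; rewrite s0 mul0r => /eqP;
  rewrite eq_sym oner_eq0.
pose zeta q := s *: xi q.
pose f q := 1 + g q (zeta q) (E ord0 q).
have vxi : vfield A U xi by exact: vfield_sub hxi.
have vz : vfield A U zeta by exact: (vfieldZ hA oU (smooth_cst U s) vxi).
have sf : smooth A U f.
  apply: (smoothD hA oU (smooth_cst U 1)).
  exact: (metric_smooth hg oU vz (frame_vfield hE ord0)).
have tE i q : U q -> tangent A q (E i q) by exact: (vfield_tangent (frame_vfield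
  hE i)).
have fp : 0 < f p.
  rewrite /f /zeta (metricZl hg _ (txi p) (tE _ _ Up)) /s.
  case: ifP => [h|/negbT]; first by rewrite mul1r ltr_pwDl.
  by rewrite -ltNge mulN1r => h; rewrite ltr_wpDr // oppr_ge0 ltW.
pose V := [set q | U q /\ f q != 0].
have oV : open V.
  rewrite openE => q [Uq fq].
  have cf := smooth_continuous hA oU sf Uq (hcover q).
  have N0 : nbhs (f q) [set x | x != 0] by apply: open_nbhs_nbhs; split=> //;
    exact: open_neq.
  have N1 : \forall r \near q, f r != 0 := cf _ N0.
  have N2 : \forall r \near q, U r by exact: open_nbhs_nbhs.
  by apply: filterS (filterI N2 N1).
have VU : V `<=` U by move=> q [].
have hEV := orthonormal_frame_sub VU hE.
have vzV := vfield_sub VU vz.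
have z1 q : V q -> g q (zeta q) (zeta q) = 1.
  by move=> _; rewrite (metricZl hg _ (txi q) (tangentZ _ (txi q))) (metricZr hg
    _ (txi q) (txi q)) xi1 mulr1.
have fV q : V q -> 1 + g q (zeta q) (E ord0 q) != 0 by case.
have vF := reflected_frame_vfield hA hg oV hEV vzV fV.
have zx q v : tangent A q v -> g q v (zeta q) = s * g q v (xi q).
  by move=> tv; rewrite (metricZr hg _ (txi q) tv).
exists V, (reflected_frame g E zeta); split=> //; first by split=> //;
  rewrite lt0r_neq0.
split=> //.
- move=> j q Vq; have tF := vfield_tangent (vF j) Vq; split=> //.
  apply: (mulfI s0); rewrite -zx // mulr0.
  rewrite (Defs.metric_sym hg tF (vfield_tangent vzV Vq)).
  exact: (reflected_frame_zeta hg hEV vzV z1 fV).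
- by move=> i j q Vq; exact: (reflected_frame_orthonormal hA hg oV hEV vzV z1 fV).
- move=> q v Vq [tv vx]; exists (fun j => g q v (reflected_frame g E zeta j q)).
  by apply: (reflected_frame_span hA hg oV hEV vzV z1 fV) => //;
    rewrite zx // vx mulr0.
Qed.

(** * Equivalence of the two equations *)

Lemma eq_half_iff (R : realType) (V : lmodType R) (L N T : V) :
  L = N - 2^-1 *: T <-> L - N = - T - (L - N).
Proof.
set h := 2^-1 *: T; have -> : T = h *+ 2.
  by rewrite -scaler_nat scalerA mulfV ?scale1r // pnatr_eq0.
(* With T = 2 h the first equation is L - N + h = 0 and the second is twice it. *)
split=> [->|/eqP E]; first by rewrite addrAC subrr sub0r opprK mulr2n opprD subrK.
have : 2 *: (L - N + h) = 0.
  by move: E; rewrite -subr_eq0 opprB opprK addrA -mulr2n -mulrnDl scaler_nat =>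
    /eqP.
move=> /eqP; rewrite scaler_eq0 pnatr_eq0 /= addrAC subr_eq0 => /eqP <-.
by rewrite addrK.
Qed.

Theorem theorem3p5 (R : realType) (n : nat) (M : topologicalType)
  (A : set (chart R M n.*2.+1))
  (g : M -> ((M -> R) -> R) -> ((M -> R) -> R) -> R)
  (nabla : M -> ((M -> R) -> R) -> (M -> (M -> R) -> R) -> ((M -> R) -> R))
  (theta : M -> ((M -> R) -> R) -> ((M -> R) -> R))
  (xi : M -> (M -> R) -> R)
  (eta : M -> ((M -> R) -> R) -> R)
  (hM : smooth_manifold A)
  (hg : riemannian_metric A g)
  (hnabla : levi_civita A g nabla)
  (hacm : almost_contact_metric A g theta xi eta)
  (hnormal : normal A theta xi eta) :
  second_harmonic_section_equation A g nabla theta xi <->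
  (forall (U : set M) (E : 'I_n.*2.+1 -> M -> (M -> R) -> R)
      (F : 'I_n.*2 -> M -> (M -> R) -> R),
    open U ->
    orthonormal_frame A g (tangent A) U E ->
    orthonormal_frame A g (horizontal A g xi) U F ->
    forall p, U p ->
    rough_laplacian nabla E xi p - norm2_nabla g nabla E xi p *: xi p =
      2^-1 *: (\sum_i curvature_theta A nabla theta (F i) (app theta (F i)) xi p)
      + nabla_theta nabla theta (delta_theta nabla theta E) xi p).
Proof.
have hA := mfd_chart hM; have hcover := mfd_cover hM.
(* For a fixed pair of frames the equations are equivalent point by point; what remains concerns the
   quantifiers over frames. *)
have main (U : set M) (E : 'I_n.*2.+1 -> M -> (M -> R) -> R)
    (F : 'I_n.*2 -> M -> (M -> R) -> R) p : open U -> orthonormal_frame A g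
      (tangent A) U E ->
    orthonormal_frame A g (horizontal A g xi) U F -> U p ->
    (rough_laplacian nabla E xi p =
       norm2_nabla g nabla E xi p *: xi p - 2^-1 *: theta p (trace_bar_J g nabla
         theta xi E p)) <->
    (rough_laplacian nabla E xi p - norm2_nabla g nabla E xi p *: xi p =
      2^-1 *: (\sum_i curvature_theta A nabla theta (F i) (app theta (F i)) xi p)
      + nabla_theta nabla theta (delta_theta nabla theta E) xi p).
  move=> oU hE hF Up.
  rewrite (second_equation_rhs hA hcover hg hnabla hacm oU hE hF hnormal Up).
  exact: (@eq_half_iff R ((M -> R) -> R)).
split=> [H U E F oU hE hF p Up|H U E oU hE p Up].
  by apply: (main U E F p oU hE hF Up).1; exact: (H U E oU hE p Up).
(* A horizontal frame is only available near p. Both equations at p involve E only through its germ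
   there, so E is restricted to V. *)
have [V [F [oV Vp VU hF]]] := exists_horizontal_frame hA hcover hg (acm_xi hacm)
  (metric_xi_xi hg hacm) oU Up hE.
have hEV := orthonormal_frame_sub VU hE.
by apply: (main V E F p oV hEV hF Vp).2; exact: (H V E F oV hEV hF p Vp).
Qed.
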